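(* Let $\mathcal{X}\subset\mathbb{R}^{n_x}$, $\mathcal{Y}\subset\mathbb{R}^{n_y}$ and payoff functions $f_t:\mathcal{X}\times\mathcal{Y}\to\mathbb{R}$, $t=0,1,2,\ldots$, satisfy the standing assumptions (A1)–(A4) listed in the context, and suppose that for every $t\ge 0$ the Nash equilibrium $(x_t^*,y_t^* )$ of $f_t$ lies in the interior of $\mathcal{X}\times\mathcal{Y}$. Let $\rho\in(0,1)$, let $$\alpha\in\Big(0,\frac{2\mu}{\mu L+L_\times^2}\Big),$$ let $(x_0,y_0)\in\mathcal{X}\times\mathcal{Y}$, and let $\{(x_t,y_t)\}_{t\ge0}$ be generated by the projected online gradient descent-ascent algorithm $$x_{t+1}=\mathcal{P}_{\mathcal{X}}\big(x_t-\alpha\nabla_x f_t(x_t,y_t)\big),\qquad y_{t+1}=\mathcal{P}_{\mathcal{Y}}\big(y_t+\alpha\nabla_y f_t(x_t,y_t)\big),\qquad t\ge0.$$ Set $$\beta=1+\tfrac12(L^2+\mu^2+2L_\times^2)\alpha^2-(L+\mu)\alpha+\tfrac12(L-\mu)\alpha\sqrt{(L\alpha+\mu\alpha-2)^2+4L_\times^2\alpha^2}.$$ Then for all $t\ge0$, $$\|x_t-x_t^*\|^2+\|y_t-y_t^*\|^2\le\beta^t\big(\|x_0-x_0^*\|^2+\|y_0-y_0^*\|^2\big)+\sum_{i=1}^t\beta^{t-i}\big(2D_{\mathcal{X}}V_i^x+2D_{\mathcal{Y}}V_i^y+(V_i^x)^2+(V_i^y)^2\big).$$ The forgetting-factor game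 regret satisfies, for every $T\ge1$, $$R_T^F\le\frac L2\sum_{t=1}^T\rho^{T-t}\beta^t\big(\|x_0-x_0^*\|^2+\|y_0-y_0^*\|^2\big)+\frac L2\sum_{i=1}^T\sum_{t=i}^T\rho^{T-t}\beta^{t-i}\big(2D_{\mathcal{X}}V_i^x+2D_{\mathcal{Y}}V_i^y+(V_i^x)^2+(V_i^y)^2\big).$$ In particular, if $V_t^x\to0$ and $V_t^y\to0$ as $t\to\infty$, then $R_T^F\to0$ as $T\to\infty$.
   Context: $\|\cdot\|$ is the Euclidean norm; $\mathcal{P}_{\mathcal{X}}(z)=\arg\min_{x\in\mathcal{X}}\|x-z\|$ is Euclidean projection onto $\mathcal{X}$ (similarly $\mathcal{P}_{\mathcal{Y}}$); $\nabla_x f,\nabla_y f$ are partial gradients. Standing assumptions. (A1) $\mathcal{X}$ and $\mathcal{Y}$ are nonempty, compact and convex; each $f_t$ is continuous and convex-concave on $\mathcal{X}\times\mathcal{Y}$ (convex in $x$ for each fixed $y$, concave in $y$ for each fixed $x$). (A2) There are $\mu_x,\mu_y>0$ such that each $f_t$ is $\mu_x$-strongly convex in $x$ for every fixed $y\in\mathcal{Y}$ and $\mu_y$-strongly concave in $y$ for every fixed $x\in\mathcal{X}$. (A3) Each $f_t$ is differentiable, and there are $L_x\ge\mu_x$, $L_y\ge\mu_y$ such that $\|\nabla_x f_t(x,y)-\nabla_x f_t(x',y)\|\le L_x\|x-x'\|$ and $\|\nabla_y f_t(x,y)-\nabla_y f_t(x,y')\|\le L_y\|y-y'\|$ for all $x,x'\in\mathcal{X}$,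 $y,y'\in\mathcal{Y}$, $t\ge0$. (A4) There are $L_{xy},L_{yx}>0$ such that $\|\nabla_x f_t(x,y)-\nabla_x f_t(x,y')\|\le L_{xy}\|y-y'\|$ and $\|\nabla_y f_t(x,y)-\nabla_y f_t(x',y)\|\le L_{yx}\|x-x'\|$ for all $x,x'\in\mathcal{X}$, $y,y'\in\mathcal{Y}$, $t\ge0$. A Nash equilibrium (NE) of $f_t$ is a pair $(x_t^*,y_t^* )\in\mathcal{X}\times\mathcal{Y}$ with $f_t(x_t^*,y)\le f_t(x_t^*,y_t^* )\le f_t(x,y_t^* )$ for all $(x,y)\in\mathcal{X}\times\mathcal{Y}$; under (A1)–(A2) it exists and is unique. Notation: $\mu=\min\{\mu_x,\mu_y\}$, $L=\max\{L_x,L_y\}$, $L_\times=\max\{L_{xy},L_{yx}\}$; $D_{\mathcal{X}}=\sup_{x,x'\in\mathcal{X}}\|x-x'\|$, $D_{\mathcal{Y}}=\sup_{y,y'\in\mathcal{Y}}\|y-y'\|$; for $t\ge1$, $V_t^x=\|x_t^*-x_{t-1}^*\|$ and $V_t^y=\|y_t^*-y_{t-1}^*\|$. Forgetting-factor game regret (for given $\rho\in(0,1)$): $R_T^F=\sum_{t=1}^T\rho^{T-t}\big(f_t(x_t,y_t^* )-f_t(x_t^*,y_t)\big)$. *)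

(* Defs.v *)
(* MathComp / MathComp-Analysis. *)
From HB Require Import structures.
From mathcomp Require Import all_boot all_order all_algebra.
From mathcomp Require Import all_classical all_reals all_analysis.

Set Implicit Arguments.
Unset Strict Implicit.
Unset Printing Implicit Defensive.

Import Order.TTheory GRing.Theory Num.Theory.
Import numFieldNormedType.Exports.

Local Open Scope classical_set_scope.
Local Open Scope ring_scope.

Definition dotp (R : realType) (n : nat) (u v : 'rV[R]_n) : R :=
  \sum_(i < n) u ord0 i * v ord0 i.

(* The library norm on 'rV[R]_n is the sup norm. It induces the same topology,
   so the library's compact, interior and continuous are used as they are, but
   every quantitative bound needs the Euclidean norm. *)
Definition enorm (R : realType) (n : nat) (u : 'rV[R]_n) : R :=
  Num.sqrt (dotp u u).

Definition diam (R : realType) (n : nat) (A : set 'rV[R]_n) : R :=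
  sup [set enorm (x - x') | x in A & x' in A].

Definition euclid_proj (R : realType) (n : nat) (A : set 'rV[R]_n) (z : 'rV[R]_n) :
    'rV[R]_n :=
  get [set p | A p /\ forall x, A x -> enorm (p - z) <= enorm (x - z)].

Definition strongly_convex (R : realType) (n : nat) (A : set 'rV[R]_n)
    (m : R) (g : 'rV[R]_n -> R) : Prop :=
  forall x x' (l : R), A x -> A x' -> 0 <= l <= 1 ->
    g (l *: x + (1 - l) *: x') <=
    l * g x + (1 - l) * g x' - m / 2 * l * (1 - l) * enorm (x - x') ^+ 2.

(* A function on A is represented by a total function of which only the values
   on A matter. Hence differentiability is taken relative to A: the increments
   range over points of A only. The derivative is unique at every point of a
   convex set with nonempty interior. *)
Definition is_grad (R : realType) (n : nat) (A : set 'rV[R]_n)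
    (g : 'rV[R]_n -> R) (a v : 'rV[R]_n) : Prop :=
  forall e : R, 0 < e -> \forall x \near within A (nbhs a),
    `|g x - g a - dotp v (x - a)| <= e * enorm (x - a).

Definition grad (R : realType) (n : nat) (A : set 'rV[R]_n)
    (g : 'rV[R]_n -> R) (a : 'rV[R]_n) : 'rV[R]_n :=
  get (is_grad A g a).

(* Joint (Frechet) differentiability on A, relative to A as above. *)
Definition differentiable_on (R : realType) (m n : nat)
    (A : set ('rV[R]_m * 'rV[R]_n)) (g : 'rV[R]_m * 'rV[R]_n -> R) : Prop :=
  forall a, A a -> exists p q, forall e : R, 0 < e ->
    \forall z \near within A (nbhs a),
      `|g z - g a - (dotp p (z.1 - a.1) + dotp q (z.2 - a.2))|
      <= e * Num.sqrt (enorm (z.1 - a.1) ^+ 2 + enorm (z.2 - a.2) ^+ 2).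

Definition gradx (R : realType) (m n : nat) (X : set 'rV[R]_m)
    (g : 'rV[R]_m * 'rV[R]_n -> R) (x : 'rV[R]_m) (y : 'rV[R]_n) : 'rV[R]_m :=
  grad X (fun x' => g (x', y)) x.

Definition grady (R : realType) (m n : nat) (Y : set 'rV[R]_n)
    (g : 'rV[R]_m * 'rV[R]_n -> R) (x : 'rV[R]_m) (y : 'rV[R]_n) : 'rV[R]_n :=
  grad Y (fun y' => g (x, y')) y.

Definition nash_eq (R : realType) (m n : nat) (X : set 'rV[R]_m)
    (Y : set 'rV[R]_n) (g : 'rV[R]_m * 'rV[R]_n -> R)
    (xs : 'rV[R]_m) (ys : 'rV[R]_n) : Prop :=
  [/\ X xs, Y ys &
    forall x y, X x -> Y y -> g (xs, y) <= g (xs, ys) <= g (x, ys)].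

(* Meaningful for 1 <= t; at t = 0 it is 0 because 0.-1 = 0. *)
Definition path_variation (R : realType) (n : nat) (u : nat -> 'rV[R]_n) (t : nat) : R :=
  enorm (u t - u t.-1).

Definition gda_rate (R : realType) (mu L Lc alpha : R) : R :=
  1 + 2^-1 * (L ^+ 2 + mu ^+ 2 + 2 * Lc ^+ 2) * alpha ^+ 2 - (L + mu) * alpha
  + 2^-1 * (L - mu) * alpha *
    Num.sqrt ((L * alpha + mu * alpha - 2) ^+ 2 + 4 * Lc ^+ 2 * alpha ^+ 2).

Definition forgetting_regret (R : realType) (m n : nat)
    (f : nat -> 'rV[R]_m * 'rV[R]_n -> R) (rho : R)
    (x xs : nat -> 'rV[R]_m) (y ys : nat -> 'rV[R]_n) (T : nat) : R :=
  \sum_(1 <= t < T.+1) rho ^+ (T - t) * (f t (x t, ys t) - f t (xs t, y t)).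

(* Main.v *)
(* Let F = (grad_x f, - grad_y f) be the saddle operator, c = (mu + L) / 2 and
   r = (L - mu) / 2. For w = (u, v) joining two points of X x Y,
   F(z + w) - F(z) = c w + (P, Q) + E, where |E| <= r |w| comes from the
   curvature in x and in y separately, |(P, Q)| <= Lc |w| from the cross
   Lipschitz constants, and <u, P> + <v, Q> = 0 from the symmetry of mixed second
   differences. As beta = (sqrt ((1 - alpha c)^2 + alpha^2 Lc^2) + alpha r)^2,
   the triangle inequality makes the gradient step a contraction of squared rate
   beta. Since f need not be twice differentiable, the symmetry is obtained in
   the limit of averages over fine grids. At an interior equilibrium F vanishes,
   and moving the target by V costs at most 2 D V + V^2 per block; both the
   error and the regret then satisfy a geometric recursion. *)
Require Import Defs.
From HB Require Import structures.
From mathcomp Require Import all_boot all_order all_algebra.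
From mathcomp Require Import all_classical all_reals all_analysis.
From mathcomp Require Import ring lra.

Set Implicit Arguments.
Unset Strict Implicit.
Unset Printing Implicit Defensive.

Import Order.TTheory GRing.Theory Num.Theory.
Import numFieldNormedType.Exports.

Local Open Scope classical_set_scope.
Local Open Scope ring_scope.

(** * Euclidean inner product and norm *)

Lemma dotpC (R : realType) n (u v : 'rV[R]_n) : dotp u v = dotp v u.
Proof. by apply: eq_bigr => i _; rewrite mulrC. Qed.

Lemma dotpDl (R : realType) n (u v w : 'rV[R]_n) :
  dotp (u + v) w = dotp u w + dotp v w.
Proof.
by rewrite /dotp -big_split; apply: eq_bigr => i _; rewrite mxE mulrDl.
Qed.

Lemma dotpZl (R : realType) n a (u w : 'rV[R]_n) :
  dotp (a *: u) w = a * dotp u w.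
Proof.
by rewrite /dotp mulr_sumr; apply: eq_bigr => i _; rewrite mxE mulrA.
Qed.

Lemma dotpDr (R : realType) n (u v w : 'rV[R]_n) :
  dotp w (u + v) = dotp w u + dotp w v.
Proof. by rewrite dotpC dotpDl !(dotpC w). Qed.

Lemma dotpZr (R : realType) n a (u w : 'rV[R]_n) :
  dotp w (a *: u) = a * dotp w u.
Proof. by rewrite dotpC dotpZl (dotpC w). Qed.

Lemma dotpNl (R : realType) n (u w : 'rV[R]_n) : dotp (- u) w = - dotp u w.
Proof. by rewrite -scaleN1r dotpZl mulN1r. Qed.

Lemma dotpNr (R : realType) n (u w : 'rV[R]_n) : dotp w (- u) = - dotp w u.
Proof. by rewrite dotpC dotpNl (dotpC w). Qed.

Lemma dotpBl (R : realType) n (u v w : 'rV[R]_n) :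
  dotp (u - v) w = dotp u w - dotp v w.
Proof. by rewrite dotpDl dotpNl. Qed.

Lemma dotp0r (R : realType) n (u : 'rV[R]_n) : dotp u 0 = 0.
Proof. by rewrite -(scale0r 0) dotpZr mul0r. Qed.

Lemma dotp_sumr (R : realType) n (u : 'rV[R]_n) (I : Type) (s : seq I) P
    (F : I -> 'rV[R]_n) :
  dotp u (\sum_(i <- s | P i) F i) = \sum_(i <- s | P i) dotp u (F i).
Proof.
by elim/big_rec2: _ => [|i a b _ <-]; rewrite ?dotp0r ?dotpDr.
Qed.

Definition dotpE := (dotpDl, dotpDr, dotpNl, dotpNr, dotpZl, dotpZr).

Lemma dotp_ge0 (R : realType) n (u : 'rV[R]_n) : 0 <= dotp u u.
Proof. by apply: sumr_ge0 => i _; rewrite -expr2 sqr_ge0. Qed.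

Lemma enorm_ge0 (R : realType) n (u : 'rV[R]_n) : 0 <= enorm u.
Proof. exact: sqrtr_ge0. Qed.

Lemma enorm_sqr (R : realType) n (u : 'rV[R]_n) : enorm u ^+ 2 = dotp u u.
Proof. by rewrite sqr_sqrtr ?dotp_ge0. Qed.

Lemma enorm0 (R : realType) n : enorm (0 : 'rV[R]_n) = 0.
Proof. by rewrite /enorm dotp0r sqrtr0. Qed.

Lemma enormZ (R : realType) n a (u : 'rV[R]_n) : enorm (a *: u) = `|a| * enorm u.
Proof.
by rewrite /enorm dotpZl dotpZr mulrA -expr2 sqrtrM ?sqr_ge0 // sqrtr_sqr.
Qed.

Lemma enormN (R : realType) n (u : 'rV[R]_n) : enorm (- u) = enorm u.
Proof. by rewrite -scaleN1r enormZ normrN1 mul1r. Qed.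

Lemma enormB (R : realType) n (u v : 'rV[R]_n) : enorm (u - v) = enorm (v - u).
Proof. by rewrite -enormN opprB. Qed.

Lemma abs_coord_le_enorm (R : realType) n (u : 'rV[R]_n) i :
  `|u ord0 i| <= enorm u.
Proof.
rewrite -sqrtr_sqr ler_sqrt ?dotp_ge0 // /dotp (bigD1 i) //= -expr2 lerDl.
by apply: sumr_ge0 => j _; rewrite -expr2 sqr_ge0.
Qed.

Lemma enorm_eq0 (R : realType) n (u : 'rV[R]_n) : enorm u = 0 -> u = 0.
Proof.
move=> u0; apply/rowP => i; rewrite !mxE; apply/eqP; rewrite -normr_le0 -u0.
exact: abs_coord_le_enorm.
Qed.

(** Cauchy-Schwarz: the squared norm of [enorm v *: u - enorm u *: v] is 2 |u| |v| (|u| |v| - <u,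
    v>), hence this product is nonnegative. *)
Lemma dotp_le (R : realType) n (u v : 'rV[R]_n) : dotp u v <= enorm u * enorm v.
Proof.
have [u0|u_gt0] := leP (enorm u) 0.
  have -> : u = 0 by apply: enorm_eq0; apply/le_anti; rewrite u0 enorm_ge0.
  by rewrite dotpC dotp0r enorm0 mul0r.
have [v0|v_gt0] := leP (enorm v) 0.
  have -> : v = 0 by apply: enorm_eq0; apply/le_anti; rewrite v0 enorm_ge0.
  by rewrite dotp0r enorm0 mulr0.
have := dotp_ge0 (enorm v *: u - enorm u *: v).
rewrite !dotpE (dotpC v u) -!enorm_sqr => h.
have {}h : 0 <= (enorm u * enorm v) * (enorm u * enorm v - dotp u v) by nra.
by move: h; rewrite pmulr_rge0 ?mulr_gt0// subr_ge0.
Qed.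

Lemma enormD (R : realType) n (u v : 'rV[R]_n) :
  enorm (u + v) <= enorm u + enorm v.
Proof.
rewrite -ler_sqr ?nnegrE ?addr_ge0 ?enorm_ge0 // enorm_sqr !dotpE (dotpC v u).
by rewrite sqrrD !enorm_sqr; have := dotp_le u v; lra.
Qed.

Lemma enorm_sum (R : realType) n (I : Type) (s : seq I) P (F : I -> 'rV[R]_n) :
  enorm (\sum_(i <- s | P i) F i) <= \sum_(i <- s | P i) enorm (F i).
Proof.
elim/big_rec2: _ => [|i a b _ h]; first by rewrite enorm0.
by rewrite (le_trans (enormD _ _))// lerD2l.
Qed.

Lemma enorm_sub_le (R : realType) n (w u v : 'rV[R]_n) :
  enorm (u - v) <= enorm (u - w) + enorm (w - v).
Proof. by rewrite -(subrKA w) enormD. Qed.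

(** Lets a Euclidean bound place a point in a sup-norm ball, that is, in a basic neighbourhood of
    the topology. *)
Lemma norm_le_enorm (R : realType) n (u : 'rV[R]_n) : `|u| <= enorm u.
Proof.
rewrite [`|u|]mx_normrE; apply: bigmax_le => [|[i j] _]; first exact: enorm_ge0.
by rewrite /= (ord1 i) abs_coord_le_enorm.
Qed.

Lemma enorm_continuous (R : realType) n : continuous (@enorm R n).
Proof.
move=> u; apply: (@continuous_comp _ _ _ (fun u => dotp u u) Num.sqrt).
  apply: continuous_big => [|i _ {}u]; first exact: add_continuous.
  by apply: (@cvgM R _ (nbhs u)); exact: (@coord_continuous R 1 n ord0 i u).
exact: sqrt_continuous.
Qed.

(** * Neighbourhoods, segments and balls *)

Lemma within_nbhs_line (R : realType) n (A : set 'rV[R]_n) (P : set 'rV[R]_n)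
    (a w : 'rV[R]_n) :
  (\forall x \near within A (nbhs a), P x) ->
  exists2 d : R, 0 < d & forall l : R, 0 <= l < d -> A (a + l *: w) -> P (a + l *: w).
Proof.
move=> /nbhs_ballP[e /= e0 eP].
(* The added 1 covers the direction [w = 0]. *)
have w0 : 0 < enorm w + 1 by rewrite ltr_pwDr ?enorm_ge0.
exists (e / (enorm w + 1)); first exact: divr_gt0.
move=> l /andP[l0 le]; apply: eP; rewrite mx_norm_ball /ball_ /=.
rewrite opprD addrA subrr sub0r normrN (le_lt_trans (norm_le_enorm _))//.
rewrite enormZ ger0_norm //; move: le; rewrite ltr_pdivlMr// => /le_lt_trans; apply.
by rewrite ler_wpM2l// lerDl.
Qed.

Lemma interior_ball (R : realType) m n (X : set 'rV[R]_m) (Y : set 'rV[R]_n)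
    (a : 'rV[R]_m) (b : 'rV[R]_n) :
  interior (X `*` Y) (a, b) ->
  (exists2 d : R, 0 < d & forall x, enorm (x - a) < d -> X x) /\
  (exists2 d : R, 0 < d & forall y, enorm (y - b) < d -> Y y).
Proof.
move=> /nbhs_ballP[e /= e0 eP]; split; exists e => // z ze.
  have [] // := eP (z, b); split; last exact: ballxx.
  rewrite /= mx_norm_ball /ball_ /= distrC (le_lt_trans (norm_le_enorm _))//.
have [] // := eP (a, z); split; first exact: ballxx.
by rewrite /= mx_norm_ball /ball_ /= distrC (le_lt_trans (norm_le_enorm _)).
Qed.

Lemma convex_set_comb (R : realType) n (X : set 'rV[R]_n)
    (a b : 'rV[R]_n) (l : R) :
  convex_set X -> X a -> X b -> 0 <= l <= 1 -> X (a + l *: (b - a)).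
Proof.
move=> Xc Xa Xb /andP[l0 l1].
have -> : a + l *: (b - a) = l *: b + (1 - l) *: a.
  by rewrite scalerBl scalerBr scale1r addrCA.
by have := Xc b a (Itv01 l0 l1); rewrite !inE => /(_ Xb Xa).
Qed.

(** * First-order bounds for convex functions with Lipschitz gradient *)

Definition lower_quad (R : realType) n (X : set 'rV[R]_n) (m : R)
    (g : 'rV[R]_n -> R) (G : 'rV[R]_n -> 'rV[R]_n) : Prop :=
  forall a b, X a -> X b ->
    g a + dotp (G a) (b - a) + m / 2 * enorm (b - a) ^+ 2 <= g b.

Definition lip_on (R : realType) m n (X : set 'rV[R]_m) (L : R)
    (G : 'rV[R]_m -> 'rV[R]_n) : Prop :=
  forall a b, X a -> X b -> enorm (G a - G b) <= L * enorm (a - b).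

Lemma le_inv_nat (R : realType) (e : R) :
  0 < e -> exists n : nat, (0 < n)%N /\ n%:R^-1 <= e.
Proof.
move=> e0; exists (Num.bound e^-1).+1; split=> //.
rewrite -[leRHS]invrK lef_pV2 ?posrE ?invr_gt0 ?ltr0Sn//.
have := archi_boundP (ltW (_ : 0 < e^-1)); rewrite invr_gt0 => /(_ e0) /ltW.
by move=> /le_trans; apply; rewrite ler_nat.
Qed.

(** Strong convexity on the segment from [a] to [b], divided by [l], becomes the first-order bound
    as [l] tends to 0. The gradient is used as a limit only here; afterwards [G] enters through
    [lower_quad] and [lip_on]. *)
Lemma strongly_convex_lower_quad (R : realType) n (X : set 'rV[R]_n) (m : R) g G :
  convex_set X -> 0 <= m -> strongly_convex X m g ->
  (forall a, X a -> is_grad X g a (G a)) -> lower_quad X m g G.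
Proof.
move=> Xc m0 gc gG a b Xa Xb; apply/ler_addgt0Pr => e e0.
set w := b - a; set D := enorm w; have D0 : 0 <= D by exact: enorm_ge0.
(* With [e = t * K], both errors fit into [e]: [t * D] from differentiability and
   [m / 2 * t * D ^+ 2] from the factor [1 - l]. *)
pose K := 1 + D + m / 2 * D ^+ 2.
have K0 : 0 < K by rewrite /K; nra.
pose t := e / K; have t0 : 0 < t by exact: divr_gt0.
have [d d0 H] := within_nbhs_line w (gG a Xa t t0).
pose l := Num.min 1 (Num.min t (d / 2)).
have l0 : 0 < l by rewrite !lt_min ltr01 t0 divr_gt0.
have l1 : l <= 1 by rewrite ge_min lexx.
have lt : l <= t by rewrite !ge_min lexx orbT.
have ld : l < d.
  by rewrite (@le_lt_trans _ _ (d / 2)) ?gtr_pMr ?invf_lt1 ?ltr1n// !ge_min lexx !orbT.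
have l01 : 0 <= l <= 1 by rewrite ltW.
have := H l; rewrite ltW // ld => /(_ isT (convex_set_comb Xc Xa Xb l01)).
rewrite /= [a + _ - a]addrAC subrr add0r enormZ (gtr0_norm l0) dotpZr ler_norml => /andP[h1 _].
have := gc b a l Xb Xa l01.
have -> : l *: b + (1 - l) *: a = a + l *: w.
  by rewrite scalerBl scalerBr scale1r addrCA.
rewrite -/w -/D => h2.
have {h1 h2} h : l * (dotp (G a) w + m / 2 * (1 - l) * D ^+ 2 - t * D
    - (g b - g a)) <= 0 by move: h1 h2; rewrite -/D; nra.
rewrite pmulr_rle0// in h.
have eE : e = t * K by rewrite /t divfK ?gt_eqF.
have : m / 2 * l * D ^+ 2 <= m / 2 * t * D ^+ 2.
  by rewrite ler_wpM2r ?sqr_ge0// ler_wpM2l ?divr_ge0.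
by rewrite eE /K; nra.
Qed.

(** Convexity traps each increment of [g] between the slopes at the two ends of the step. The gap
    between right and left Riemann sums telescopes, so no integral is involved. *)
Lemma riemann_sum_bound (R : realType) n (X : set 'rV[R]_n) (m : R) g G
    (p : nat -> 'rV[R]_n) e N :
  0 <= m -> lower_quad X m g G ->
  (forall i, (i <= N)%N -> X (p i)) ->
  (forall i, (i < N)%N -> p i.+1 - p i = e) ->
  0 <= g (p N) - g (p 0%N) - \sum_(0 <= i < N) dotp (G (p i)) e
    <= dotp (G (p N) - G (p 0%N)) e.
Proof.
move=> m0 gG Xp pe.
rewrite -(telescope_sumr (fun i => g (p i)) (leq0n N)).
rewrite -(telescope_sumr (fun i => G (p i)) (leq0n N)) -sumrB dotpC dotp_sumr.
have E i : (i < N)%N -> dotp (G (p i)) e <= g (p i.+1) - g (p i)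
    <= dotp (G (p i.+1)) e.
  move=> iN; have := gG _ _ (Xp _ (ltnW iN)) (Xp _ iN).
  have := gG _ _ (Xp _ iN) (Xp _ (ltnW iN)).
  rewrite -opprB enormN pe // dotpNr => h1 h2.
  have : 0 <= m / 2 * enorm e ^+ 2 by rewrite mulr_ge0 ?sqr_ge0 ?divr_ge0.
  by move=> h3; apply/andP; split; lra.
apply/andP; split.
  rewrite big_nat; apply: sumr_ge0 => i /= iN.
  by case/andP: (E i iN) => h1 h2; rewrite subr_ge0.
rewrite big_nat [leRHS]big_nat; apply: ler_sum => i /= iN.
by case/andP: (E i iN) => h1 h2; rewrite [leRHS]dotpC dotpBl lerD2r.
Qed.

Lemma sum_nat_le (R : realType) N :
  \sum_(0 <= i < N) i%:R <= (N%:R ^+ 2 / 2 : R).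
Proof.
elim: N => [|N IH]; first by rewrite big_geq// expr0n mul0r.
by rewrite big_nat_recr //= -natr1; nra.
Qed.

(** On a grid of [N] steps the left Riemann sum exceeds [dotp (G a) w] by at most L D^2 times the
    sum of i / N^2, which is at most L D^2 / 2. The Riemann error L D^2 / N vanishes as [N]
    grows. *)
Lemma descent (R : realType) n (X : set 'rV[R]_n) (m L : R) g G a b :
  convex_set X -> 0 <= m -> lower_quad X m g G -> 0 <= L -> lip_on X L G ->
  X a -> X b ->
  g b <= g a + dotp (G a) (b - a) + L / 2 * enorm (b - a) ^+ 2.
Proof.
move=> Xc m0 gG L0 lipG Xa Xb; set w := b - a.
set D := enorm w; have D0 : 0 <= D by exact: enorm_ge0.
apply/ler_addgt0Pr => e e0.
have K0 : 0 < 1 + L * D ^+ 2 by nra.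
have [N [N0 Ne]] := le_inv_nat (divr_gt0 e0 K0).
have N0' : (N%:R : R) != 0 by rewrite pnatr_eq0 -lt0n.
set h : R := N%:R^-1; have h0 : 0 <= h by rewrite invr_ge0.
pose p i : 'rV[R]_n := a + (i%:R * h) *: w.
have Xp i : (i <= N)%N -> X (p i).
  move=> iN; apply: convex_set_comb => //; rewrite mulr_ge0//=.
  by rewrite ler_pdivrMr ?ltr0n// mul1r ler_nat.
have pe i : (i < N)%N -> p i.+1 - p i = h *: w.
  by move=> _; rewrite /p -natr1 opprD addrACA subrr add0r -scalerBl mulrDl mul1r addrAC subrr add0r.
have := riemann_sum_bound m0 gG Xp pe.
have -> : p N = b by rewrite /p mulfV// scale1r addrC subrK.
have -> : p 0%N = a by rewrite /p mul0r scale0r addr0.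
move=> /andP[_ H].
have H1 : dotp (G b - G a) (h *: w) <= h * (L * D ^+ 2).
  rewrite dotpZr ler_wpM2l// (le_trans (dotp_le _ _))// expr2 mulrA.
  by rewrite ler_wpM2r// lipG.
have H2 : \sum_(0 <= i < N) dotp (G (p i)) (h *: w) <=
    dotp (G a) w + L / 2 * D ^+ 2.
  apply: (@le_trans _ _ (\sum_(0 <= i < N) (h * dotp (G a) w + i%:R * (h ^+ 2 * (L * D ^+ 2))))).
    rewrite big_nat [leRHS]big_nat; apply: ler_sum => i /= iN.
    rewrite dotpZr -[G (p i)](subrK (G a)) dotpDl mulrDr addrC lerD2l.
    have : dotp (G (p i) - G a) w <= L * (i%:R * h * D) * D.
      rewrite (le_trans (dotp_le _ _))// ler_wpM2r//.
      rewrite (le_trans (lipG _ _ (Xp _ (ltnW iN)) Xa))// /p addrAC subrr add0r.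
      by rewrite enormZ ger0_norm// mulr_ge0.
    by move=> /(ler_wpM2l h0) /le_trans; apply; rewrite le_eqVlt; apply/orP; left; apply/eqP; ring.
  rewrite big_split /= sumr_const_nat subn0 -mulr_suml.
  have -> : (h * dotp (G a) w) *+ N = dotp (G a) w.
    by rewrite -mulr_natr mulrAC mulVf// mul1r.
  rewrite lerD2l.
  have LD : 0 <= h ^+ 2 * (L * D ^+ 2) by rewrite !mulr_ge0 ?sqr_ge0.
  rewrite (le_trans (ler_wpM2r LD (sum_nat_le R N)))//.
  rewrite le_eqVlt; apply/orP; left; apply/eqP.
  by rewrite /h; field.
have H3 : h * (L * D ^+ 2) <= e.
  move: Ne; rewrite -/h ler_pdivlMr//; nra.
by lra.
Qed.

(** * Lipschitz bound for the gradient after removal of its central linear part *)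

Lemma enorm_le_dotp (R : realType) n (d : 'rV[R]_n) (k : R) :
  0 <= k -> (forall z, enorm z <= 1 -> dotp d z <= k) -> enorm d <= k.
Proof.
move=> k0 H; have [d0|d0] := leP (enorm d) 0; first exact: le_trans d0 k0.
have := H ((enorm d)^-1 *: d); rewrite enormZ ger0_norm ?invr_ge0 ?enorm_ge0//.
by rewrite mulVf ?gt_eqF// dotpZr -enorm_sqr expr2 mulKf ?gt_eqF//; apply.
Qed.

(* Comparing the quadratic bounds of g at b and at a in the two points
   a + (b - a) / 2 +- z bounds the gradient increment in every direction z. *)
Lemma centered_lip_near (R : realType) n (X : set 'rV[R]_n) (m L : R) g G a b :
  convex_set X -> 0 <= m -> m <= L -> lower_quad X m g G -> lip_on X L G ->
  X a -> X b ->
  (forall z, enorm z <= enorm (b - a) / 2 -> X (a + 2^-1 *: (b - a) + z)) ->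
  enorm (G b - G a - ((m + L) / 2) *: (b - a)) <= (L - m) / 2 * enorm (b - a).
Proof.
move=> Xc m0 mL gG lipG Xa Xb.
have [w wE] : exists w, w = b - a by exists (b - a).
rewrite -wE => room; set c := (m + L) / 2.
have L0 : 0 <= L by exact: le_trans mL.
have D0 : 0 <= enorm w by exact: enorm_ge0.
apply: enorm_le_dotp => [|z z1]; first by rewrite mulr_ge0// divr_ge0// subr_ge0.
have [w0|w0] := leP (enorm w) 0.
  have -> : w = 0 by apply: enorm_eq0; apply/le_anti; rewrite w0.
  have eab : b = a by apply/eqP; rewrite -subr_eq0 -wE; apply/eqP/enorm_eq0/le_anti; rewrite w0.
  by rewrite eab scaler0 subr0 subrr enorm0 mulr0 dotpC dotp0r.
(* The length |w| / 2 bounds |y|^2 by |w|^2 / 4, matching the other quadratic term; the sign turns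
   the one-sided bound below into one in direction [z]. *)
have [y yE] : exists y, y = - ((enorm w / 2) *: z) by eexists.
have ynorm : enorm y <= enorm w / 2.
  by rewrite yE enormN enormZ ger0_norm ?divr_ge0// ler_piMr// divr_ge0.
have Xp := room _ ynorm.
have Xn : X (a + 2^-1 *: w - y) by apply: room; rewrite enormN.
have pa : a + 2^-1 *: w + y - a = 2^-1 *: w + y by rewrite -(addrA a) [a + _]addrC addrK.
have na : a + 2^-1 *: w - y - a = 2^-1 *: w - y by rewrite -(addrA a) [a + _]addrC addrK.
have bE : b = a + 2^-1 *: w + 2^-1 *: w.
  by rewrite -addrA -scalerDl -[2^-1]mul1r -splitr scale1r wE addrC subrK.
have pb : a + 2^-1 *: w + y - b = y - 2^-1 *: w by rewrite bE addrAC opprD addrA subrr add0r addrC.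
have nb : a + 2^-1 *: w - y - b = - y - 2^-1 *: w by rewrite bE addrAC opprD addrA subrr add0r addrC.
(* Summing [h1] to [h4] cancels all values of [g] and leaves -2 <G b - G a - c w, y> <= (L - m)
   (|w|^2 / 4 + |y|^2). *)
have h1 := gG _ _ Xa Xp; have h2 := gG _ _ Xb Xn.
have h3 := descent Xc m0 gG L0 lipG Xb Xp.
have h4 := descent Xc m0 gG L0 lipG Xa Xn.
rewrite pa in h1; rewrite nb in h2; rewrite pb in h3; rewrite na in h4.
rewrite !enorm_sqr !dotpE ?(dotpC y w) in h1 h2 h3 h4.
have ysq : dotp y y <= (enorm w) ^+ 2 / 4.
  by rewrite -enorm_sqr; have := enorm_ge0 y; nra.
have : - dotp (G b - G a - c *: w) y <= (L - m) / 2 * enorm w * (enorm w / 2).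
  have wsq := enorm_sqr w.
  have : (L - m) * dotp y y <= (L - m) * (dotp w w / 4).
    by rewrite ler_wpM2l ?subr_ge0// -wsq.
  have -> : (L - m) / 2 * enorm w * (enorm w / 2) = (L - m) / 4 * dotp w w.
    by rewrite -wsq; field.
  by move: h1 h2 h3 h4; rewrite !dotpE ?(dotpC y w) /c; lra.
rewrite yE dotpNr opprK dotpZr mulrAC mulrC => h.
by rewrite -(ler_pM2l w0); nra.
Qed.

(** Cut the segment into steps shorter than [d], so that each has the room asked for by
    [centered_lip_near]. All steps are the same multiple of [w], so the bounds add up with no loss
    of constant. *)
Lemma centered_lip_interior (R : realType) n (X : set 'rV[R]_n) (m L d : R) g G
    (a b : 'rV[R]_n) :
  convex_set X -> 0 <= m -> m <= L -> lower_quad X m g G -> lip_on X L G ->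
  0 < d -> (forall x, enorm (x - a) < d -> X x) ->
  (forall x, enorm (x - b) < d -> X x) ->
  enorm (G b - G a - ((m + L) / 2) *: (b - a)) <= (L - m) / 2 * enorm (b - a).
Proof.
move=> Xc m0 mL gG lipG d0 Xa Xb; set c := (m + L) / 2.
have [w wE] : exists w, w = b - a by eexists.
rewrite -wE; have D0 := enorm_ge0 w.
have [N [N0 Ne]] := le_inv_nat (divr_gt0 d0 (ltr_pwDr ltr01 D0)).
have N0' : (N%:R : R) != 0 by rewrite pnatr_eq0 -lt0n.
set h : R := N%:R^-1 in Ne *; have h0 : 0 <= h by rewrite invr_ge0.
have hd : h * enorm w < d.
  have K0 : 0 < enorm w + 1 by rewrite ltr_wpDl.
  rewrite (le_lt_trans (ler_wpM2r D0 Ne))// mulrAC ltr_pdivrMr// ltr_pM2l//.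
  by rewrite ltrDl.
have addDDK u : (b + u) - (a + u) = b - a.
  by rewrite opprD addrACA subrr addr0.
pose p i : 'rV[R]_n := a + (i%:R * h) *: w.
have pe i : p i.+1 = p i + h *: w.
  by rewrite /p -natr1 mulrDl mul1r scalerDl addrA.
have ballp i x : (i <= N)%N -> enorm (x - p i) < d -> X x.
  (* Translating both ends by [x - p i] translates the point dividing the segment, so the whole
     segment inherits the ball of radius [d]. *)
  move=> iN xp; have -> : x = (a + (x - p i)) + (i%:R * h) *: ((b + (x - p i)) - (a + (x - p i))).
    by rewrite addDDK -wE addrAC -/(p i) addrC subrK.
  apply: convex_set_comb => //.
  - by apply: Xa; rewrite addrC addKr.
  - by apply: Xb; rewrite addrC addKr.
  - by rewrite mulr_ge0//= ler_pdivrMr ?ltr0n// mul1r ler_nat.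
have Xp i : (i <= N)%N -> X (p i).
  by move=> iN; apply: (ballp i) => //; rewrite subrr enorm0.
have step i : (i < N)%N ->
    enorm (G (p i.+1) - G (p i) - (c * h) *: w) <= (L - m) / 2 * (h * enorm w).
  move=> iN.
  have hE : p i.+1 - p i = h *: w by rewrite pe addrC addKr.
  have nE : enorm (h *: w) = h * enorm w by rewrite enormZ ger0_norm.
  have := centered_lip_near Xc m0 mL gG lipG (Xp _ (ltnW iN)) (Xp _ iN).
  rewrite hE nE scalerA; apply => z zle; apply: (ballp i); first exact: ltnW.
  rewrite -(addrA (p i)) [p i + _]addrC addrK (le_lt_trans (enormD _ _))//.
  rewrite scalerA enormZ ger0_norm ?mulr_ge0//.
  by rewrite (le_lt_trans _ hd)//; lra.
have -> : G b - G a - c *: w =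
    \sum_(0 <= i < N) (G (p i.+1) - G (p i) - (c * h) *: w).
  rewrite sumrB (telescope_sumr (fun i => G (p i)) (leq0n N)) sumr_const_nat subn0.
  rewrite {2}/p mul0r scale0r addr0 -scaler_nat scalerA.
  have -> : N%:R * (c * h) = c by rewrite mulrCA mulfV// mulr1.
  by rewrite /p mulfV// scale1r wE [a + _]addrC subrK.
rewrite (le_trans (enorm_sum _ _ _))// big_nat.
apply: (@le_trans _ _ (\sum_(0 <= i < N) ((L - m) / 2 * (h * enorm w)))).
  by rewrite [leRHS]big_nat; apply: ler_sum => i /= iN; exact: step.
rewrite sumr_const_nat subn0 -[leLHS]mulr_natl.
rewrite [leLHS](_ : _ = (L - m) / 2 * enorm w * (N%:R * h)); last by ring.
by rewrite mulfV// mulr1.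
Qed.

(** Shrinking [a] and [b] towards [x0] by the factor [l] makes both interior; the Lipschitz bound on
    [G] controls the change, and [l] tends to 0. *)
Lemma centered_lip (R : realType) n (X : set 'rV[R]_n) (m L d : R) g G
    (x0 a b : 'rV[R]_n) :
  convex_set X -> 0 <= m -> m <= L -> lower_quad X m g G -> lip_on X L G ->
  0 < d -> (forall x, enorm (x - x0) < d -> X x) -> X a -> X b ->
  enorm (G b - G a - ((m + L) / 2) *: (b - a)) <= (L - m) / 2 * enorm (b - a).
Proof.
move=> Xc m0 mL gG lipG d0 X0 Xa Xb; set c := (m + L) / 2.
have L0 : 0 <= L by exact: le_trans mL.
have c0 : 0 <= c by rewrite divr_ge0// addr_ge0.
have r0 : 0 <= (L - m) / 2 by rewrite divr_ge0// subr_ge0.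
apply/ler_addgt0Pr => e e0.
(* [l * K] pays for moving the two gradients, through [L], and for shortening [b - a] in the linear
   term, through [c]. *)
pose K := (L + c) * (enorm (x0 - a) + enorm (x0 - b)).
have K0 : 0 <= K by rewrite mulr_ge0// addr_ge0// enorm_ge0.
pose l := Num.min 1 (e / (K + 1)).
have l0 : 0 < l by rewrite lt_min ltr01 divr_gt0// ltr_wpDl.
have l1 : l <= 1 by rewrite ge_min lexx.
have lK : l * K <= e.
  have : l <= e / (K + 1) by rewrite ge_min lexx orbT.
  by rewrite ler_pdivlMr ?ltr_wpDl//; nra.
(* This ball is the image of the ball about [x0] under the homothety of centre [y] and ratio [l],
   which preserves [X] by convexity. *)
have room y x : X y -> enorm (x - (y + l *: (x0 - y))) < l * d -> X x.
  move=> Xy hx; pose z := x0 + l^-1 *: (x - (y + l *: (x0 - y))).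
  have -> : x = y + l *: (z - y).
    rewrite /z addrAC scalerDr scalerA mulfV ?gt_eqF// scale1r addrA.
    by rewrite addrC subrK.
  apply: convex_set_comb => //; last by rewrite ltW.
  apply: X0; rewrite /z addrC addKr enormZ gtr0_norm ?invr_gt0//.
  by rewrite mulrC ltr_pdivrMr// mulrC.
set a' := a + l *: (x0 - a); set b' := b + l *: (x0 - b).
have ld : 0 < l * d by exact: mulr_gt0.
have Xa' : X a' by apply: (room a) => //; rewrite subrr enorm0.
have Xb' : X b' by apply: (room b) => //; rewrite subrr enorm0.
have := centered_lip_interior Xc m0 mL gG lipG ld (fun x => room a x Xa)
  (fun x => room b x Xb).
rewrite -/a' -/b' -/c.
have -> : b' - a' = (1 - l) *: (b - a).
  by apply/rowP => i; rewrite !mxE; ring.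
have nE : enorm ((1 - l) *: (b - a)) <= enorm (b - a).
  rewrite enormZ ger0_norm ?subr_ge0// ler_piMl ?enorm_ge0//.
  by rewrite gerBl ltW.
move=> h.
have {h} h1 : enorm (G b' - G a' - c *: ((1 - l) *: (b - a))) <=
    (L - m) / 2 * enorm (b - a) by rewrite (le_trans h)// ler_wpM2l.
have step y : X y -> enorm (G (y + l *: (x0 - y)) - G y) <= L * (l * enorm (x0 - y)).
  move=> Xy; have -> : l * enorm (x0 - y) = enorm (y + l *: (x0 - y) - y).
    by rewrite [y + _]addrC addrK enormZ gtr0_norm.
  by apply: lipG => //; apply: (room y) => //; rewrite subrr enorm0.
have -> : G b - G a - c *: (b - a) = (G b' - G a' - c *: ((1 - l) *: (b - a)))
    + (G a' - G a) - (G b' - G b) - (c * l) *: (b - a).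
  by apply/rowP => i; rewrite !mxE; ring.
rewrite (le_trans (enormD _ _))// (le_trans (lerD (enormD _ _) (lexx _)))//.
rewrite (le_trans (lerD (lerD (enormD _ _) (lexx _)) (lexx _)))//.
have := step a Xa; have := step b Xb; rewrite -/a' -/b' !enormN => h2 h3.
have h4 : enorm ((c * l) *: (b - a)) <= c * l * (enorm (x0 - b) + enorm (x0 - a)).
  have cl : 0 <= c * l by rewrite mulr_ge0// ltW.
  rewrite enormZ ger0_norm// ler_wpM2l//.
  by rewrite (le_trans (enorm_sub_le x0 _ _))// (enormB b).
by move: lK; rewrite /K; lra.
Qed.

(** * Averages over fine grids and symmetry of mixed differences *)

Lemma enorm_sum_nat_le (R : realType) n (N : nat) (F : nat -> 'rV[R]_n) (k : R) :
  (forall i, (i < N)%N -> enorm (F i) <= k) ->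
  enorm (\sum_(0 <= i < N) F i) <= N%:R * k.
Proof.
move=> Fk; rewrite (le_trans (enorm_sum _ _ _))// mulr_natl -[N in leRHS]subn0.
rewrite -sumr_const_nat big_nat [leRHS]big_nat.
by apply: ler_sum => i /= iN; exact: Fk.
Qed.

(** A discrete stand-in for the part of the diagonal increment due to the second index. Each [i]
    contributes the square window from [i] to [i + m] in both indices, so that the averages for the
    two players range over the same squares; [i < m * m - m] keeps the windows inside the grid. *)
Definition strip_mean (R : realType) n (H : nat -> nat -> 'rV[R]_n) (m : nat) :=
  (m * m)%:R^-1 *: \sum_(0 <= i < m * m - m) \sum_(0 <= p < m)
    (H (i + p)%N (i + m)%N - H (i + p)%N i).

Lemma walk_le (R : realType) n (H : nat -> 'rV[R]_n) (s : R) i k :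
  (forall l, (i <= l < i + k)%N -> enorm (H l.+1 - H l) <= s) ->
  enorm (H (i + k)%N - H i) <= k%:R * s.
Proof.
elim: k => [|k IH] Hs; first by rewrite addn0 subrr enorm0 mul0r.
rewrite addnS (le_trans (enorm_sub_le (H (i + k)%N) _ _))// -natr1 mulrDl mul1r.
rewrite addrC lerD//.
  by apply: IH => l /andP[il lk]; apply: Hs; rewrite il addnS ltnW.
by apply: Hs; rewrite addnS leq_addr/=.
Qed.

Lemma strip_mean_le (R : realType) n (H : nat -> nat -> 'rV[R]_n) (s : R) m :
  (0 < m)%N -> 0 <= s ->
  (forall i j, (i <= m * m)%N -> (j < m * m)%N ->
    enorm (H i j.+1 - H i j) <= s) ->
  enorm (strip_mean H m) <= (m * m)%:R * s.
Proof.
move=> m0 s0 Hs; rewrite /strip_mean enormZ ger0_norm ?invr_ge0 ?ler0n//.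
have M0 : 0 < (m * m)%:R :> R by rewrite ltr0n muln_gt0 m0.
rewrite mulrC ler_pdivrMr//.
have : enorm (\sum_(0 <= i < m * m - m) \sum_(0 <= p < m)
    (H (i + p)%N (i + m)%N - H (i + p)%N i)) <= (m * m - m)%:R * (m%:R * (m%:R * s)).
  apply: enorm_sum_nat_le => i iN; apply: enorm_sum_nat_le => p pm.
  apply: walk_le => l /andP[il lm]; apply: Hs.
    by rewrite (leq_trans (leq_add (ltnW iN) (ltnW pm)))// subnK// leq_pmulr.
  by rewrite (leq_trans lm)// -[leqRHS](subnK (leq_pmulr m m0)) leq_add2r ltnW.
move=> /le_trans; apply; rewrite -mulrA ler_pM ?mulr_ge0 ?ler0n//.
  by rewrite ler_nat leq_subr.
by rewrite natrM mulrA mulrC mulrA.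
Qed.

(* Averaging the increment of H from (p, q) to (p + n, q + n), n = m^2 - m,
   over 0 <= p, q < m and splitting every diagonal step into a step in the first
   index and one in the second, the steps of the second kind telescope in q and
   add up to [strip_mean H m]. *)
Lemma strip_mean_increment (R : realType) n (H : nat -> nat -> 'rV[R]_n)
    (e : 'rV[R]_n) (r s : R) m :
  (0 < m)%N -> 0 <= r -> 0 <= s ->
  (forall i j, (i < m * m)%N -> (j <= m * m)%N ->
    enorm (H i.+1 j - H i j - e) <= r) ->
  (forall i j, (i <= m * m)%N -> (j < m * m)%N ->
    enorm (H i j.+1 - H i j) <= s) ->
  enorm (H (m * m)%N (m * m)%N - H 0%N 0%N - (m * m)%:R *: e - strip_mean H m)
    <= (m * m)%:R * r + 3 * m%:R * (r + enorm e + s).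
Proof.
move=> m0 r0 s0 Hr Hs; set M := (m * m)%N; pose N := (M - m)%N.
have mM : (m <= M)%N by rewrite leq_pmulr.
have NM : (N + m = M)%N by rewrite subnK.
have M0 : 0 < M%:R :> R by rewrite ltr0n muln_gt0 m0.
have Hr' i j : (i < M)%N -> (j <= M)%N -> enorm (H i.+1 j - H i j) <= r + enorm e.
  move=> iM jM; rewrite -(subrK e (_ - _)) (le_trans (enormD _ _))// lerD2r.
  exact: Hr.
have re0 : 0 <= r + enorm e by rewrite addr_ge0 ?enorm_ge0.
have walk i j i' j' : (i + i' <= M)%N -> (j + j' <= M)%N -> (i' <= m)%N -> (j' <= m)%N ->
    enorm (H (i + i')%N (j + j')%N - H i j) <= m%:R * (r + enorm e + s).
  move=> iM jM im jm; rewrite (le_trans (enorm_sub_le (H i (j + j')%N) _ _))//.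
  rewrite mulrDr lerD//.
    apply: (@le_trans _ _ (i'%:R * (r + enorm e))); last by rewrite ler_wpM2r// ler_nat.
    apply: (@walk_le _ _ (fun l => H l (j + j')%N)) => l /andP[_ li].
    by apply: Hr' => //; exact: leq_trans li iM.
  apply: (@le_trans _ _ (j'%:R * s)); last by rewrite ler_wpM2r// ler_nat.
  apply: (@walk_le _ _ (fun l => H i l)) => l /andP[_ lj].
  by apply: Hs; [exact: leq_trans (leq_addr _ _) iM | exact: leq_trans lj jM].
pose step p q i := H (i.+1 + p)%N (i.+1 + q)%N - H (i + p)%N (i.+1 + q)%N - e.
(* The shifted diagonal has only [N = M - m] steps. Its two end gaps and the [m] missing copies of
   [e] are the three terms behind the factor 3 of the bound. *)
pose Z p q := (H M M - H (N + p)%N (N + q)%N) + (H p q - H 0%N 0%N) - m%:R *: e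
  + \sum_(0 <= i < N) step p q i.
have key : M%:R *: (H M M - H 0%N 0%N - M%:R *: e - strip_mean H m) =
    \sum_(0 <= p < m) \sum_(0 <= q < m) Z p q.
  have -> : \sum_(0 <= p < m) \sum_(0 <= q < m) Z p q =
      \sum_(0 <= p < m) \sum_(0 <= q < m) (H M M - H 0%N 0%N - M%:R *: e)
      - \sum_(0 <= p < m) \sum_(0 <= q < m) \sum_(0 <= i < N)
        (H (i + p)%N (i + q).+1 - H (i + p)%N (i + q)%N).
    rewrite -sumrB; apply: eq_bigr => p _; rewrite -sumrB; apply: eq_bigr => q _.
    have E : H (N + p)%N (N + q)%N - H p q = \sum_(0 <= i < N) (step p q i + e)
       + \sum_(0 <= i < N) (H (i + p)%N (i + q).+1 - H (i + p)%N (i + q)%N).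
      rewrite -[LHS](telescope_sumr (fun i => H (i + p)%N (i + q)%N) (leq0n N)).
      by rewrite -big_split; apply: eq_bigr => i _; rewrite /step/= subrK subrKA.
    rewrite big_split /= sumr_const_nat subn0 -scaler_nat in E.
    have eM : M%:R = N%:R + m%:R :> R by rewrite -natrD NM.
    rewrite /Z eM; move/eqP: E; rewrite subr_eq => /eqP ->.
    by apply/rowP => i; rewrite !mxE; ring.
  rewrite scalerBr; congr (_ - _).
    by rewrite !sumr_const_nat !subn0 -mulrnA !scaler_nat.
  rewrite /strip_mean scalerA mulfV ?gt_eqF// scale1r exchange_big /=.
  under [RHS]eq_bigr do rewrite exchange_big /=.
  apply: eq_bigr => p _; apply: eq_bigr => i _.
  under eq_bigr do rewrite -addnS.
  by rewrite (telescope_sumr (fun q => H (i + p)%N (i + q)%N) (leq0n m)) addn0.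
rewrite -(ler_pM2l M0) -[X in X * enorm _](gtr0_norm M0) -enormZ key.
rewrite [X in _ <= X * _]natrM -[leRHS]mulrA.
apply: enorm_sum_nat_le => p pm; apply: enorm_sum_nat_le => q qm.
have h1 : enorm (H M M - H (N + p)%N (N + q)%N) <= m%:R * (r + enorm e + s).
  have := walk (N + p)%N (N + q)%N (m - p)%N (m - q)%N.
  by rewrite -!addnA (subnKC (ltnW pm)) (subnKC (ltnW qm)) NM => h; apply: h; rewrite ?leqnn ?leq_subr.
have h2 : enorm (H p q - H 0%N 0%N) <= m%:R * (r + enorm e + s).
  by apply: (walk 0%N 0%N) => //; rewrite ?add0n 1?ltnW// (leq_trans _ mM)// ltnW.
have h3 : enorm (m%:R *: e) <= m%:R * (r + enorm e + s).
  by rewrite enormZ ger0_norm ?ler0n// ler_wpM2l ?ler0n//; lra.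
have h4 : enorm (\sum_(0 <= i < N) step p q i) <= M%:R * r.
  apply: (@le_trans _ _ (N%:R * r)); last by rewrite ler_wpM2r// ler_nat leq_subr.
  apply: enorm_sum_nat_le => i iN; apply: Hr.
    by rewrite -/M -NM -addnS leq_add// ltnW.
  by rewrite -/M -NM leq_add// ltnW.
rewrite /Z (le_trans (enormD _ _))// (le_trans (lerD (enormD _ _) (lexx _)))//.
rewrite (le_trans (lerD (lerD (enormD _ _) (lexx _)) (lexx _)))// enormN.
by lra.
Qed.

(** Both Riemann errors lie between 0 and the same bound, so their difference is within that bound
    with no factor 2. It is used for two slices of a function, where the difference of increments is
    a mixed second difference. *)
Lemma mixed_riemann_bound (R : realType) n (X : set 'rV[R]_n) (m L : R) g1 g2 G1 G2
    (p : nat -> 'rV[R]_n) e N :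
  0 <= m -> lower_quad X m g1 G1 -> lower_quad X m g2 G2 ->
  lip_on X L G1 -> lip_on X L G2 -> 
  (forall i, (i <= N)%N -> X (p i)) ->
  (forall i, (i < N)%N -> p i.+1 - p i = e) ->
  `| \sum_(0 <= i < N) dotp (G1 (p i) - G2 (p i)) e
     - (g1 (p N) - g1 (p 0%N) - (g2 (p N) - g2 (p 0%N))) |
    <= L * (N%:R * enorm e) * enorm e.
Proof.
move=> m0 gG1 gG2 lip1 lip2 Xp pe.
have pN : p N - p 0%N = N%:R *: e.
  rewrite -(telescope_sumr p (leq0n N)) big_nat.
  by rewrite (eq_bigr (fun=> e)) -?big_nat ?sumr_const_nat ?subn0 ?scaler_nat// => i /= /pe.
have B G : lip_on X L G -> dotp (G (p N) - G (p 0%N)) e <= L * (N%:R * enorm e) * enorm e.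
  move=> lipG; rewrite (le_trans (dotp_le _ _))// ler_wpM2r ?enorm_ge0//.
  rewrite -[N%:R](ger0_norm (ler0n R N)) -enormZ -pN.
  by apply: lipG; exact: Xp.
have /andP[h1 h2] := riemann_sum_bound m0 gG1 Xp pe.
have /andP[h3 h4] := riemann_sum_bound m0 gG2 Xp pe.
have := B _ lip1; have := B _ lip2.
under eq_bigr do rewrite dotpBl.
by rewrite sumrB => h5 h6; rewrite ler_norml; apply/andP; split; lra.
Qed.

(* Gx and Gy are gradients of f in the first and of - f in the second variable. *)
Definition smooth_saddle (R : realType) k l (X : set 'rV[R]_k) (Y : set 'rV[R]_l)
    (mu L Lc : R) (f : 'rV[R]_k * 'rV[R]_l -> R)
    (Gx : 'rV[R]_k -> 'rV[R]_l -> 'rV[R]_k)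
    (Gy : 'rV[R]_k -> 'rV[R]_l -> 'rV[R]_l) : Prop :=
  (forall b, Y b -> [/\ lower_quad X mu (fun a => f (a, b)) (Gx^~ b),
                        lip_on X L (Gx^~ b) & lip_on X Lc (Gy^~ b)]) /\
  (forall a, X a -> [/\ lower_quad Y mu (fun b => - f (a, b)) (Gy a),
                        lip_on Y L (Gy a) & lip_on Y Lc (Gx a)]).

(* A grid of mesh 1 / m^2 on the rectangle spanned by u and v. The two inner
   products are, up to sign and an error O(1 / m), one and the same sum of mixed
   second differences of f: for a twice differentiable f this is the
   skew-symmetry of the off-diagonal blocks of the saddle Hessian. *)
Lemma saddle_increment (R : realType) k l (X : set 'rV[R]_k) (Y : set 'rV[R]_l)
    (mu L Lc d : R) f Gx Gy (x0 a a' : 'rV[R]_k) (y0 b b' : 'rV[R]_l) (eps : R) :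
  convex_set X -> convex_set Y -> 0 <= mu -> mu <= L -> 0 <= Lc ->
  smooth_saddle X Y mu L Lc f Gx Gy ->
  0 < d -> (forall x, enorm (x - x0) < d -> X x) ->
  (forall y, enorm (y - y0) < d -> Y y) ->
  X a -> X a' -> Y b -> Y b' -> 0 < eps ->
  exists P Q, [/\ enorm P <= Lc * enorm (b' - b), enorm Q <= Lc * enorm (a' - a),
    `|dotp (a' - a) P + dotp (b' - b) Q| <= eps,
    enorm (Gx a' b' - Gx a b - ((mu + L) / 2) *: (a' - a) - P)
      <= (L - mu) / 2 * enorm (a' - a) + eps &
    enorm (Gy a' b' - Gy a b - ((mu + L) / 2) *: (b' - b) - Q)
      <= (L - mu) / 2 * enorm (b' - b) + eps].
Proof.
move=> Xc Yc mu0 muL Lc0 [fX fY] d0 Bx By Xa Xa' Yb Yb' eps0.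
have L0 : 0 <= L by exact: le_trans muL.
have [u uE] : exists u, u = a' - a by eexists.
have [v vE] : exists v, v = b' - b by eexists.
have [c cE] : exists c, c = (mu + L) / 2 by eexists.
have [r rE] : exists r, r = (L - mu) / 2 by eexists.
rewrite -uE -vE -cE -rE.
have u0 := enorm_ge0 u; have v0 := enorm_ge0 v.
have c0 : 0 <= c by rewrite cE divr_ge0// addr_ge0.
have r0 : 0 <= r by rewrite rE divr_ge0// subr_ge0.
(* The first summand controls the defect of orthogonality, the second the boundary terms of
   [strip_mean_increment]; both occur divided by [m]. *)
pose K := L * (enorm u ^+ 2 + enorm v ^+ 2)
  + 3 * ((r + c + Lc) * (enorm u + enorm v)).
have K0 : 0 <= K by rewrite /K addr_ge0 ?mulr_ge0 ?addr_ge0 ?sqr_ge0.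
have [m [m0 me]] := le_inv_nat (divr_gt0 eps0 (ltr_pwDr ltr01 K0)).
have m0' : 0 < m%:R :> R by rewrite ltr0n.
have im0 : 0 <= (m%:R : R)^-1 by rewrite invr_ge0 ltW.
have Km : K / m%:R <= eps.
  rewrite (le_trans (ler_wpM2l K0 me))// mulrCA -[leRHS]mulr1 ler_pM2l//.
  by rewrite ler_pdivrMr ?ltr_wpDl// mul1r lerDl.
pose M := (m * m)%N; have M0 : 0 < M%:R :> R by rewrite ltr0n muln_gt0 m0.
have [h hE] : exists h, h = M%:R^-1 :> R by eexists.
have h0 : 0 <= h by rewrite hE invr_ge0 ltW.
have Mh : M%:R * h = 1 by rewrite hE mulfV ?gt_eqF.
have mh : m%:R * h = m%:R^-1.
  by apply: (mulfI (lt0r_neq0 m0')); rewrite mulrA -natrM Mh mulfV ?gt_eqF.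
have [p pE] : exists p : nat -> 'rV[R]_k, forall i, p i = a + (i%:R * h) *: u by eexists.
have [q qE] : exists q : nat -> 'rV[R]_l, forall i, q i = b + (i%:R * h) *: v by eexists.
have ih i : (i <= M)%N -> 0 <= i%:R * h <= 1.
  by move=> iM; rewrite mulr_ge0//= hE ler_pdivrMr// mul1r ler_nat.
have Xp i : (i <= M)%N -> X (p i) by move=> /ih; rewrite pE uE; exact: convex_set_comb.
have Yq i : (i <= M)%N -> Y (q i) by move=> /ih; rewrite qE vE; exact: convex_set_comb.
have pS i : p i.+1 - p i = h *: u by rewrite !pE; apply/rowP => j; rewrite !mxE -natr1; ring.
have qS i : q i.+1 - q i = h *: v by rewrite !qE; apply/rowP => j; rewrite !mxE -natr1; ring.
have p0 : p 0%N = a by rewrite pE mul0r scale0r addr0.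
have q0 : q 0%N = b by rewrite qE mul0r scale0r addr0.
have pM : p M = a' by rewrite pE Mh scale1r uE addrC subrK.
have qM : q M = b' by rewrite qE Mh scale1r vE addrC subrK.
have hu : enorm (h *: u) = h * enorm u by rewrite enormZ ger0_norm.
have hv : enorm (h *: v) = h * enorm v by rewrite enormZ ger0_norm.
(* The indices of [Hy] are swapped so that the first one always moves the player's own variable. *)
pose Hx i j := Gx (p i) (q j); pose Hy i j := Gy (p j) (q i).
have Hx1 i j : (i < M)%N -> (j <= M)%N ->
    enorm (Hx i.+1 j - Hx i j - (c * h) *: u) <= r * h * enorm u.
  move=> iM jM; have [gX lX _] := fX _ (Yq _ jM).
  have := centered_lip Xc mu0 muL gX lX d0 Bx (Xp _ (ltnW iM)) (Xp _ iM).
  by rewrite pS -cE -rE hu scalerA mulrA.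
have Hy1 i j : (i < M)%N -> (j <= M)%N ->
    enorm (Hy i.+1 j - Hy i j - (c * h) *: v) <= r * h * enorm v.
  move=> iM jM; have [gY lY _] := fY _ (Xp _ jM).
  have := centered_lip Yc mu0 muL gY lY d0 By (Yq _ (ltnW iM)) (Yq _ iM).
  by rewrite qS -cE -rE hv scalerA mulrA.
have Hx2 i j : (i <= M)%N -> (j < M)%N -> enorm (Hx i j.+1 - Hx i j) <= Lc * (h * enorm v).
  move=> iM jM; have [_ _ lY] := fY _ (Xp _ iM).
  by rewrite -hv -(qS j); exact: lY (Yq _ jM) (Yq _ (ltnW jM)).
have Hy2 i j : (i <= M)%N -> (j < M)%N -> enorm (Hy i j.+1 - Hy i j) <= Lc * (h * enorm u).
  move=> iM jM; have [_ _ lX] := fX _ (Yq _ iM).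
  by rewrite -hu -(pS j); exact: lX (Xp _ jM) (Xp _ (ltnW jM)).
have Mhx t w : M%:R * (t * (h * w)) = t * w.
  by rewrite mulrCA (mulrA M%:R) Mh mul1r.
have rhu0 w : 0 <= w -> 0 <= r * h * w by move=> w0; rewrite !mulr_ge0.
have Lchu0 w : 0 <= w -> 0 <= Lc * (h * w) by move=> w0; rewrite !mulr_ge0.
have chu n (w : 'rV[R]_n) : M%:R *: ((c * h) *: w) = c *: w.
  by rewrite scalerA mulrCA Mh mulr1.
have chn n (w : 'rV[R]_n) : enorm ((c * h) *: w) = c * h * enorm w.
  by rewrite enormZ ger0_norm// mulr_ge0.
have LK : L * (enorm u ^+ 2 + enorm v ^+ 2) / m%:R <= eps.
  rewrite (le_trans _ Km)// ler_wpM2r// /K lerDl.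
  by rewrite !mulr_ge0 ?addr_ge0.
have rK w w' : 0 <= w -> w <= enorm u + enorm v -> 0 <= w' -> w' <= enorm u + enorm v ->
    3 * m%:R * (r * h * w + c * h * w + Lc * (h * w')) <= eps.
  move=> w0 wuv w'0 w'uv; rewrite (le_trans _ Km)//.
  have -> : 3 * m%:R * (r * h * w + c * h * w + Lc * (h * w')) =
    3 * ((r + c) * w + Lc * w') * (m%:R * h) by ring.
  rewrite mh ler_wpM2r// /K.
  have h1 : (r + c) * w <= (r + c) * (enorm u + enorm v) by rewrite ler_wpM2l// addr_ge0.
  have h2 : Lc * w' <= Lc * (enorm u + enorm v) by rewrite ler_wpM2l.
  have h3 : 0 <= L * (enorm u ^+ 2 + enorm v ^+ 2) by rewrite mulr_ge0// addr_ge0 ?sqr_ge0.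
  by lra.
exists (strip_mean Hx m), (strip_mean Hy m); split.
- rewrite (le_trans (strip_mean_le m0 (Lchu0 _ v0) Hx2))//.
  by rewrite Mhx.
- rewrite (le_trans (strip_mean_le m0 (Lchu0 _ u0) Hy2))//.
  by rewrite Mhx.
- have h0' : 0 < h by rewrite hE invr_gt0.
  (* The factor [h] turns [u] and [v] into the mesh vectors, so the inner sums become Riemann sums
     along the grid. *)
  have E : h * (dotp u (strip_mean Hx m) + dotp v (strip_mean Hy m)) =
      M%:R^-1 * \sum_(0 <= i < M - m) (
        \sum_(0 <= j < m) dotp (Gx (p (i + j)%N) (q (i + m)%N) - Gx (p (i + j)%N) (q i)) (h *: u)
      + \sum_(0 <= j < m) dotp (Gy (p (i + m)%N) (q (i + j)%N) - Gy (p i) (q (i + j)%N)) (h *: v)).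
    rewrite /strip_mean !dotpZr -mulrDr mulrCA !dotp_sumr -big_split mulr_sumr.
    congr (_ * _); apply: eq_bigr => i _; rewrite /= !dotp_sumr mulrDr !mulr_sumr.
    by congr (_ + _); apply: eq_bigr => j _; rewrite dotpZr dotpC.
  pose B := L * (m%:R * (h * enorm u)) * (h * enorm u) + L * (m%:R * (h * enorm v)) * (h * enorm v).
  have B0 : 0 <= B by rewrite addr_ge0// !mulr_ge0.
  (* The first sum approximates the mixed second difference of [f] over the window, the second that
     of [- f] over the same window: they cancel up to the two Riemann errors, whose sum is [B]. *)
  have S i : (i < M - m)%N -> `|
        \sum_(0 <= j < m) dotp (Gx (p (i + j)%N) (q (i + m)%N) - Gx (p (i + j)%N) (q i)) (h *: u)
      + \sum_(0 <= j < m) dotp (Gy (p (i + m)%N) (q (i + j)%N) - Gy (p i) (q (i + j)%N)) (h *: v)|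
      <= B.
    move=> iM; have imM : (i + m <= M)%N by rewrite addnC -leq_subRL ?leq_pmulr// ltnW.
    have ijM j : (j <= m)%N -> (i + j <= M)%N.
      by move=> jm; apply: leq_trans imM; rewrite leq_add2l.
    have iM' : (i <= M)%N by rewrite -[i]addn0 ijM.
    have [gX1 lX1 _] := fX _ (Yq _ imM); have [gX2 lX2 _] := fX _ (Yq _ iM').
    have [gY1 lY1 _] := fY _ (Xp _ imM); have [gY2 lY2 _] := fY _ (Xp _ iM').
    have pS' j : (j < m)%N -> p (i + j.+1)%N - p (i + j)%N = h *: u by rewrite addnS pS.
    have qS' j : (j < m)%N -> q (i + j.+1)%N - q (i + j)%N = h *: v by rewrite addnS qS.
    have := mixed_riemann_bound mu0 gX1 gX2 lX1 lX2
      (fun j jm => Xp _ (ijM j jm)) pS'.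
    have := mixed_riemann_bound mu0 gY1 gY2 lY1 lY2
      (fun j jm => Yq _ (ijM j jm)) qS'.
    rewrite hu hv addn0 => h1 h2; apply: le_trans (le_trans (ler_normD _ _) (lerD h2 h1)).
    by rewrite le_eqVlt; apply/orP; left; apply/eqP; congr (`|_|); ring.
  rewrite -(ler_pM2l h0') -[X in X * `|_|](gtr0_norm h0') -normrM E normrM.
  rewrite gtr0_norm ?invr_gt0// mulrC ler_pdivrMr//.
  rewrite (_ : h * eps * M%:R = eps); last by rewrite mulrAC [h * _]mulrC Mh mul1r.
  have MB : M%:R * B <= eps.
    rewrite (le_trans _ LK)// /B -mh le_eqVlt; apply/orP; left; apply/eqP.
    transitivity ((M%:R * h) * (L * (enorm u ^+ 2 + enorm v ^+ 2) * (m%:R * h))); first by ring.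
    by rewrite Mh mul1r.
  apply: (le_trans _ MB); rewrite (le_trans (ler_norm_sum _ _ _))//.
  apply: (@le_trans _ _ (\sum_(0 <= i < M - m) B)).
    by rewrite big_nat [leRHS]big_nat; apply: ler_sum => i /= iM; exact: S.
  by rewrite sumr_const_nat subn0 -[leLHS]mulr_natl ler_wpM2r// ler_nat leq_subr.
- have := strip_mean_increment m0 (rhu0 _ u0) (Lchu0 _ v0) Hx1 Hx2.
  rewrite -/M chu chn /Hx p0 q0 pM qM => /le_trans; apply.
  rewrite lerD ?rK ?lerDl ?lerDr//.
  by rewrite -(mulrA r) Mhx.
- have := strip_mean_increment m0 (rhu0 _ v0) (Lchu0 _ u0) Hy1 Hy2.
  rewrite -/M chu chn /Hy p0 q0 pM qM => /le_trans; apply.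
  rewrite lerD ?rK ?lerDl ?lerDr//.
  by rewrite -(mulrA r) Mhx.
Qed.

(** * The rate and the contraction of the gradient step *)

Lemma enorm_row_mx (R : realType) k l (u : 'rV[R]_k) (v : 'rV[R]_l) :
  enorm (row_mx u v) ^+ 2 = enorm u ^+ 2 + enorm v ^+ 2.
Proof.
rewrite !enorm_sqr /dotp big_split_ord; congr (_ + _).
  by apply: eq_bigr => i _; rewrite row_mxEl.
by apply: eq_bigr => i _; rewrite row_mxEr.
Qed.

(** The radicand in [gda_rate] is four times the one here; the other terms come from expanding the
    square. *)
Lemma gda_rateE (R : realType) (mu L Lc alpha : R) :
  gda_rate mu L Lc alpha =
  (Num.sqrt ((1 - alpha * ((mu + L) / 2)) ^+ 2 + (alpha * Lc) ^+ 2)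
   + alpha * ((L - mu) / 2)) ^+ 2.
Proof.
set x := _ ^+ 2 + _ ^+ 2; have x0 : 0 <= x by rewrite addr_ge0 ?sqr_ge0.
rewrite /gda_rate; have -> : (L * alpha + mu * alpha - 2) ^+ 2 + 4 * Lc ^+ 2 * alpha ^+ 2
   = 2 ^+ 2 * x by rewrite /x; field.
rewrite sqrtrM ?sqr_ge0// sqrtr_sqr ger0_norm// [RHS]sqrrD sqr_sqrtr// /x.
by field.
Qed.

Lemma gda_rate_ge0 (R : realType) (mu L Lc alpha : R) : 0 <= gda_rate mu L Lc alpha.
Proof. by rewrite gda_rateE sqr_ge0. Qed.

(** With c = (mu + L) / 2 and r = (L - mu) / 2, the claim is (1 - alpha c)^2 + (alpha Lc)^2 < (1 -
    alpha r)^2. As c - r = mu and c^2 - r^2 = mu L, the gap is alpha (2 mu - alpha (mu L + Lc^2)),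
    positive by the step size condition. *)
Lemma gda_rate_lt1 (R : realType) (mu L Lc alpha : R) :
  0 < mu -> mu <= L -> 0 < Lc -> 0 < alpha -> alpha < 2 * mu / (mu * L + Lc ^+ 2) ->
  gda_rate mu L Lc alpha < 1.
Proof.
move=> mu0 muL Lc0 a0; have L0 : 0 < L by exact: lt_le_trans muL.
rewrite ltr_pdivlMr ?addr_gt0 ?mulr_gt0 ?exprn_gt0// => aL.
have r0 : 0 <= alpha * ((L - mu) / 2) by rewrite mulr_ge0 ?divr_ge0 ?subr_ge0// ltW.
have L2 : 0 < Lc ^+ 2 by rewrite exprn_gt0.
(* This gives alpha (L - mu) / 2 < 1, so the right side is positive before squaring. *)
have aL2 : alpha * L < 2.
  rewrite -(ltr_pM2l mu0); have : 0 < alpha * Lc ^+ 2 by exact: mulr_gt0.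
  by nra.
have r1 : alpha * ((L - mu) / 2) < 1 by nra.
rewrite gda_rateE -[ltRHS](expr1n _ 2) ltr_sqr ?nnegrE ?addr_ge0 ?sqrtr_ge0//.
rewrite -ltrBrDr -[ltRHS]gtr0_norm ?subr_gt0// -sqrtr_sqr ltr_sqrt ?exprn_gt0 ?subr_gt0//.
rewrite -subr_gt0 (_ : _ - _ = alpha * (2 * mu - alpha * (mu * L + Lc ^+ 2))).
  by rewrite mulr_gt0// subr_gt0.
by field.
Qed.

(* With c = (mu + L) / 2 and r = (L - mu) / 2 the increment of the saddle
   operator is c w + K + E with K almost orthogonal to w, |K| <= Lc |w| and
   |E| <= r |w|, so that
   |w - alpha (c w + K + E)| <= |(1 - alpha c) w - alpha K| + alpha |E|. *)
Lemma gda_contraction (R : realType) k l (X : set 'rV[R]_k) (Y : set 'rV[R]_l)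
    (mu L Lc d alpha : R) f Gx Gy (x0 a a' : 'rV[R]_k) (y0 b b' : 'rV[R]_l) :
  convex_set X -> convex_set Y -> 0 <= mu -> mu <= L -> 0 <= Lc ->
  smooth_saddle X Y mu L Lc f Gx Gy ->
  0 < d -> (forall x, enorm (x - x0) < d -> X x) ->
  (forall y, enorm (y - y0) < d -> Y y) ->
  X a -> X a' -> Y b -> Y b' -> 0 <= alpha ->
  enorm (a' - a - alpha *: (Gx a' b' - Gx a b)) ^+ 2 +
  enorm (b' - b - alpha *: (Gy a' b' - Gy a b)) ^+ 2 <=
  gda_rate mu L Lc alpha * (enorm (a' - a) ^+ 2 + enorm (b' - b) ^+ 2).
Proof.
move=> Xc Yc mu0 muL Lc0 fS d0 Bx By Xa Xa' Yb Yb' al0.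
have incr eps := saddle_increment Xc Yc mu0 muL Lc0 fS d0 Bx By Xa Xa' Yb Yb' (eps := eps).
rewrite gda_rateE.
move: (a' - a) (b' - b) (Gx a' b' - Gx a b) (Gy a' b' - Gy a b) incr => u v gx gy incr.
have : 0 <= (L - mu) / 2 by rewrite divr_ge0// subr_ge0.
move: ((mu + L) / 2) ((L - mu) / 2) incr => c r incr r0.
set S := Num.sqrt _; have S0 : 0 <= S by exact: sqrtr_ge0.
have SE : S ^+ 2 = (1 - alpha * c) ^+ 2 + (alpha * Lc) ^+ 2.
  by rewrite sqr_sqrtr// addr_ge0 ?sqr_ge0.
(* Joining the two blocks into one vector makes the triangle inequality available for the pair. *)
rewrite -!enorm_row_mx -exprMn.
set w := row_mx u v; set N := enorm w; have N0 : 0 <= N by exact: enorm_ge0.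
have N2 : N ^+ 2 = enorm u ^+ 2 + enorm v ^+ 2 by exact: enorm_row_mx.
have uN : enorm u <= N by rewrite -ler_sqr ?nnegrE ?enorm_ge0// N2 lerDl sqr_ge0.
have vN : enorm v <= N by rewrite -ler_sqr ?nnegrE ?enorm_ge0// N2 lerDr sqr_ge0.
have SN : 0 <= (S + alpha * r) * N by rewrite mulr_ge0// addr_ge0// mulr_ge0.
rewrite ler_sqr ?nnegrE ?enorm_ge0//.
pose ka := 2 * alpha * `|1 - alpha * c|.
have ka0 : 0 <= ka by rewrite !mulr_ge0.
apply/ler_addgt0Pr => e e0.
(* The budget: [(ka + 1) * t] for the nearly orthogonal part and [2 * alpha * t] for the error
   part. *)
have [t tE] : exists t, t = e / (ka + 1 + 2 * alpha) by eexists.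
have K0 : 0 < ka + 1 + 2 * alpha by lra.
have t0 : 0 < t by rewrite tE divr_gt0.
have t0' : 0 <= t by exact: ltW.
have {}tE : (ka + 1 + 2 * alpha) * t = e by rewrite tE mulrC divfK// gt_eqF.
(* The accuracy [t] serves the gradient errors; [t ^+ 2] serves the orthogonality defect, which
   enters a squared norm. *)
have dl0 : 0 < Num.min t (t ^+ 2) by rewrite lt_min t0 exprn_gt0.
have [P [Q []]] := incr _ dl0.
have : Num.min t (t ^+ 2) <= t ^+ 2 by rewrite ge_min lexx orbT.
have : Num.min t (t ^+ 2) <= t by rewrite ge_min lexx.
move: (Num.min t (t ^+ 2)) => dl dlt dlt2 P1 Q1 PQ E1 E2.
have -> : row_mx (u - alpha *: gx) (v - alpha *: gy) =
   row_mx ((1 - alpha * c) *: u - alpha *: P) ((1 - alpha * c) *: v - alpha *: Q)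
   - alpha *: row_mx (gx - c *: u - P) (gy - c *: v - Q).
  rewrite scale_row_mx opp_row_mx add_row_mx.
  by congr row_mx; apply/rowP => i; rewrite !mxE; ring.
rewrite (le_trans (enormD _ _))// enormN enormZ ger0_norm//.
have h1 : enorm (row_mx (gx - c *: u - P) (gy - c *: v - Q)) <= r * N + 2 * t.
  rewrite -ler_sqr ?nnegrE ?enorm_ge0 ?addr_ge0 ?mulr_ge0// enorm_row_mx.
  have F1 : enorm (gx - c *: u - P) ^+ 2 <= (r * enorm u + t) ^+ 2.
    rewrite ler_sqr ?nnegrE ?enorm_ge0 ?addr_ge0 ?mulr_ge0 ?enorm_ge0//.
    by rewrite (le_trans E1)// lerD2l.
  have F2 : enorm (gy - c *: v - Q) ^+ 2 <= (r * enorm v + t) ^+ 2.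
    rewrite ler_sqr ?nnegrE ?enorm_ge0 ?addr_ge0 ?mulr_ge0 ?enorm_ge0//.
    by rewrite (le_trans E2)// lerD2l.
  have F3 : r * t * enorm u <= r * t * N by rewrite ler_wpM2l// mulr_ge0.
  have F4 : r * t * enorm v <= r * t * N by rewrite ler_wpM2l// mulr_ge0.
  have -> : (r * N + 2 * t) ^+ 2 = r ^+ 2 * N ^+ 2 + 4 * (r * t * N) + 4 * t ^+ 2 by ring.
  have := sqr_ge0 t; rewrite N2; move: F1 F2; rewrite !sqrrD; lra.
have h2 : enorm (row_mx ((1 - alpha * c) *: u - alpha *: P)
      ((1 - alpha * c) *: v - alpha *: Q)) <= S * N + (ka + 1) * t.
  have SNt : 0 <= S * N + (ka + 1) * t by rewrite addr_ge0// mulr_ge0// addr_ge0.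
  rewrite -ler_sqr ?nnegrE ?enorm_ge0// enorm_row_mx.
  have eE n (x z : 'rV[R]_n) : enorm ((1 - alpha * c) *: x - alpha *: z) ^+ 2 =
     (1 - alpha * c) ^+ 2 * enorm x ^+ 2 + alpha ^+ 2 * enorm z ^+ 2
     - 2 * alpha * (1 - alpha * c) * dotp x z.
    by rewrite !enorm_sqr !dotpE (dotpC z x); ring.
  rewrite !eE.
  have F1 : enorm P ^+ 2 <= (Lc * enorm v) ^+ 2.
    by rewrite ler_sqr ?nnegrE ?enorm_ge0 ?mulr_ge0 ?enorm_ge0.
  have F2 : enorm Q ^+ 2 <= (Lc * enorm u) ^+ 2.
    by rewrite ler_sqr ?nnegrE ?enorm_ge0 ?mulr_ge0 ?enorm_ge0.
  have F3 : - (2 * alpha * (1 - alpha * c) * (dotp u P + dotp v Q)) <= ka * t ^+ 2.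
    rewrite (le_trans (ler_norm _))// normrN 2!normrM [`|2 * alpha|]ger0_norm ?mulr_ge0//.
    by rewrite -/ka ler_wpM2l// (le_trans PQ).
  have F4 : alpha ^+ 2 * (enorm P ^+ 2 + enorm Q ^+ 2) <= alpha ^+ 2 * (Lc ^+ 2 * N ^+ 2).
    rewrite ler_wpM2l ?sqr_ge0// N2; move: F1 F2; rewrite !exprMn; lra.
  have F5 : ka * t ^+ 2 <= ((ka + 1) * t) ^+ 2.
    by rewrite exprMn ler_wpM2r ?sqr_ge0//; nra.
  have F6 : 0 <= S * N * ((ka + 1) * t) by rewrite mulr_ge0 ?mulr_ge0// addr_ge0.
  have -> : (S * N + (ka + 1) * t) ^+ 2 = S ^+ 2 * N ^+ 2
      + 2 * (S * N * ((ka + 1) * t)) + ((ka + 1) * t) ^+ 2 by ring.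
  rewrite SE; move: F3 F4; rewrite N2 exprMn; lra.
have h3 : alpha * enorm (row_mx (gx - c *: u - P) (gy - c *: v - Q)) <= alpha * (r * N + 2 * t).
  by rewrite ler_wpM2l.
by rewrite -tE; lra.
Qed.

(** * Projection, diameter, stationarity and partial gradients *)

Lemma euclid_projP (R : realType) n (X : set 'rV[R]_n) z :
  X !=set0 -> compact X ->
  X (euclid_proj X z) /\
  forall x, X x -> enorm (euclid_proj X z - z) <= enorm (x - z).
Proof.
move=> X0 Xcpt.
(* [euclid_proj] is a choice by [get], so it meets its specification once a minimiser exists. *)
suff ex_min : exists p, X p /\ forall x, X x -> enorm (p - z) <= enorm (x - z).
  exact: (getPex ex_min).
have cont : {within X, continuous (fun x => enorm (x - z))}.
  apply: continuous_subspaceT => x.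
  apply: (@continuous_comp _ _ _ (fun x : 'rV[R]_n => x - z) (@enorm R n)).
    apply: (@continuousB R _ _ id (cst z)); [exact: cvg_id|exact: cst_continuous].
  exact: enorm_continuous.
have [p Xp pmin] := EVT_min_rV X0 Xcpt cont.
exists p; split=> [|x Xx]; first exact: set_mem.
by apply: pmin; exact: mem_set.
Qed.

(** Moving the projection p slightly towards [x] cannot reduce the distance to [z], so <p - z, x -
    p> >= 0; expanding |z - x|^2 around p then gives the bound. *)
Lemma euclid_proj_le (R : realType) n (X : set 'rV[R]_n) z x :
  convex_set X -> compact X -> X x -> enorm (euclid_proj X z - x) <= enorm (z - x).
Proof.
move=> Xc Xcpt Xx; have [Xp pmin] := euclid_projP z (ex_intro _ x Xx) Xcpt.
move: (euclid_proj X z) Xp pmin => p Xp pmin.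
rewrite -ler_sqr ?nnegrE ?enorm_ge0//.
have [w wE] : exists w, w = x - p by eexists.
have [q qE] : exists q, q = p - z by eexists.
have -> : p - x = - w by rewrite wE opprB.
have -> : z - x = - (q + w) by rewrite wE qE; apply/rowP => i; rewrite !mxE; ring.
rewrite !enormN !enorm_sqr !dotpE (dotpC w q).
have q0 := dotp_ge0 q; have w0 := dotp_ge0 w.
suff : 0 <= dotp q w by lra.
apply/ler_addgt0Pr => e e0.
pose l := Num.min 1 (e / (dotp w w + 1)).
have l0 : 0 < l by rewrite lt_min ltr01 divr_gt0// ltr_wpDl.
have l1 : l <= 1 by rewrite ge_min lexx.
have lw : l * dotp w w <= e.
  have : l <= e / (dotp w w + 1) by rewrite ge_min lexx orbT.
  by rewrite ler_pdivlMr ?ltr_wpDl//; nra.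
have Xl : X (p + l *: (x - p)) by apply: convex_set_comb => //; rewrite ltW.
have := pmin _ Xl.
rewrite -ler_sqr ?nnegrE ?enorm_ge0// -wE addrAC -qE !enorm_sqr !dotpE (dotpC w q) => h.
have {}h : 0 <= l * (2 * dotp q w + l * dotp w w) by lra.
rewrite pmulr_rge0// in h.
by lra.
Qed.

(** [diam] is a [sup], an upper bound once the set of distances is bounded; twice the largest norm
    on the compact set bounds it. *)
Lemma le_diam (R : realType) n (X : set 'rV[R]_n) a b :
  compact X -> X a -> X b -> enorm (a - b) <= diam X.
Proof.
move=> Xcpt Xa Xb; apply: ub_le_sup; last by exists a => //; exists b.
have [c _ cmax] := @EVT_max_rV R n (@enorm R n) X (ex_intro _ a Xa) Xcpt
  (continuous_subspaceT (@enorm_continuous R n)).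
exists (enorm c + enorm c) => _ [x Xx [y Xy <-]].
by rewrite (le_trans (enormD _ _))// enormN lerD// cmax//; exact: mem_set.
Qed.

Lemma grad_interior_min (R : realType) n (X : set 'rV[R]_n) (m L d : R) g G a :
  convex_set X -> 0 <= m -> lower_quad X m g G -> 0 <= L -> lip_on X L G ->
  0 < d -> (forall x, enorm (x - a) < d -> X x) ->
  (forall x, X x -> g a <= g x) -> G a = 0.
Proof.
move=> Xc m0 gG L0 lipG d0 Bx amin.
have Xa : X a by apply: Bx; rewrite subrr enorm0.
have v0 := enorm_ge0 (G a).
have K0 : 0 < enorm (G a) + 1 by rewrite ltr_wpDl.
have K1 : 0 < L + 1 by rewrite ltr_wpDl.
(* The first bound makes a gradient step decrease [g] by at least l |G a|^2 / 2, the second keeps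
   the step inside the ball. *)
pose l := Num.min (L + 1)^-1 (d / 2 / (enorm (G a) + 1)).
have l0 : 0 < l by rewrite lt_min invr_gt0 K1 !divr_gt0.
have lL : l * (L + 1) <= 1 by rewrite -ler_pdivlMr// mul1r ge_min lexx.
have ld : l * (enorm (G a) + 1) <= d / 2 by rewrite -ler_pdivlMr// ge_min lexx orbT.
have dE : a - l *: G a - a = - (l *: G a) by rewrite addrC addKr.
have Xb : X (a - l *: G a).
  by apply: Bx; rewrite dE enormN enormZ gtr0_norm//; nra.
have := le_trans (amin _ Xb) (descent Xc m0 gG L0 lipG Xa Xb).
rewrite dE enormN enorm_sqr !dotpE -enorm_sqr => h.
have V0 := sqr_ge0 (enorm (G a)).
have {}h : l * ((1 - L / 2 * l) * enorm (G a) ^+ 2) <= 0 by lra.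
rewrite pmulr_rle0// in h.
have Ll : L / 2 * l <= 2^-1 by nra.
have {}h : enorm (G a) ^+ 2 <= 0 by nra.
by apply: enorm_eq0; apply/eqP; rewrite -sqrf_eq0; apply/eqP/le_anti; rewrite h.
Qed.

Lemma is_gradN (R : realType) n (A : set 'rV[R]_n) g a v :
  is_grad A g a v -> is_grad A (fun x => - g x) a (- v).
Proof.
move=> gv e e0; apply: filterS (gv e e0) => x.
by rewrite dotpNl -!opprD normrN.
Qed.

(** Restricting joint differentiability to a slice yields a partial gradient, which makes the choice
    in [grad] a genuine one. *)
Lemma gradx_is_grad (R : realType) m n (X : set 'rV[R]_m) (Y : set 'rV[R]_n) g a b :
  differentiable_on (X `*` Y) g -> X a -> Y b ->
  is_grad X (fun x => g (x, b)) a (gradx X g a b).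
Proof.
move=> gd Xa Yb; have [p [q gpq]] := gd (a, b) (conj Xa Yb).
rewrite /gradx /grad; suff ex_grad : exists v, is_grad X (fun x => g (x, b)) a v by exact: (getPex ex_grad).
exists p => e e0; have /nbhs_ballP[d /= d0 dP] := gpq e e0.
apply/nbhs_ballP; exists d => //= x xd Xx.
have := dP (x, b) (conj xd (ballxx _ d0)) (conj Xx Yb).
by rewrite /= subrr dotp0r addr0 enorm0 expr0n /= addr0 sqrtr_sqr (ger0_norm (enorm_ge0 _)).
Qed.

Lemma grady_is_grad (R : realType) m n (X : set 'rV[R]_m) (Y : set 'rV[R]_n) g a b :
  differentiable_on (X `*` Y) g -> X a -> Y b ->
  is_grad Y (fun y => g (a, y)) b (grady Y g a b).
Proof.
move=> gd Xa Yb; have [p [q gpq]] := gd (a, b) (conj Xa Yb).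
rewrite /grady /grad; suff ex_grad : exists v, is_grad Y (fun y => g (a, y)) b v by exact: (getPex ex_grad).
exists q => e e0; have /nbhs_ballP[d /= d0 dP] := gpq e e0.
apply/nbhs_ballP; exists d => //= y yd Yy.
have := dP (a, y) (conj (ballxx _ d0) yd) (conj Xa Yy).
by rewrite /= subrr dotp0r add0r enorm0 expr0n /= add0r sqrtr_sqr (ger0_norm (enorm_ge0 _)).
Qed.

(** * Geometric recursions *)

Lemma geometric_recursion_le (R : realType) (e W : nat -> R) (q : R) t :
  0 <= q -> (forall n, e n.+1 <= q * e n + W n.+1) ->
  e t <= q ^+ t * e 0%N + \sum_(1 <= i < t.+1) q ^+ (t - i) * W i.
Proof.
move=> q0 He; elim: t => [|t IH]; first by rewrite big_geq// expr0 mul1r addr0.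
rewrite (le_trans (He t))// big_nat_recr//= subnn expr0 mul1r addrA lerD2r.
rewrite (le_trans (ler_wpM2l q0 IH))// mulrDr exprS mulrA lerD2l mulr_sumr.
rewrite [leLHS]big_nat [leRHS]big_nat; apply: ler_sum => i /andP[_ it].
by rewrite subSn// exprS mulrA.
Qed.

Lemma sum_triangle (R : realType) (F : nat -> nat -> R) T :
  \sum_(1 <= t < T.+1) \sum_(1 <= i < t.+1) F t i =
  \sum_(1 <= i < T.+1) \sum_(i <= t < T.+1) F t i.
Proof.
elim: T => [|T IH]; first by rewrite !big_geq.
rewrite big_nat_recr//= IH [RHS]big_nat_recr//= big_nat1 [X in _ + X]big_nat_recr//= addrA.
congr (_ + _); rewrite -big_split big_nat [RHS]big_nat; apply: eq_bigr => i /andP[_ iT].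
by rewrite /= [RHS]big_nat_recr// ltnW.
Qed.

(** Once [w] stays below (1 - q) e / 2, the recursion preserves the level e / 2, and the excess over
    it decays like q^j. *)
Lemma geometric_recursion_cvg0 (R : realType) (a w : nat -> R) (q : R) :
  0 <= q < 1 -> (forall n, 0 <= a n) -> (forall n, a n.+1 <= q * a n + w n) ->
  w n @[n --> \oo] --> (0 : R) -> a n @[n --> \oo] --> (0 : R).
Proof.
move=> /andP[q0 q1] a0 Ha w0; apply/cvgr0Pnorm_le => e e0.
have q1' : 0 < 1 - q by rewrite subr_gt0.
have e2 : 0 < e / 2 by rewrite divr_gt0.
have /cvgr0Pnorm_le /(_ _ (mulr_gt0 e2 q1')) [N _ wN] := w0.
have decay j : a (N + j)%N <= e / 2 + q ^+ j * a N.
  elim: j => [|j IH]; first by rewrite addn0 mul1r lerDr ltW.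
  have := wN (N + j)%N (leq_addr _ _); rewrite /= ler_norml => /andP[_ h].
  rewrite addnS (le_trans (Ha _))// exprS; have := ler_wpM2l q0 IH; nra.
have /cvgr0Pnorm_le /(_ _ e2) [K _ aK] : q ^+ j * a N @[j --> \oo] --> (0 : R).
  rewrite -(mul0r (a N)); apply: cvgM; last exact: cvg_cst.
  by apply: cvg_expr; rewrite ger0_norm.
exists (N + K)%N => // n /= NKn; rewrite ger0_norm//.
have Nn : (N <= n)%N by exact: leq_trans (leq_addr _ _) NKn.
rewrite -(subnKC Nn) (le_trans (decay _))// [leRHS]splitr lerD2l.
have := aK (n - N)%N; rewrite /= leq_subRL// NKn => /(_ isT).
by apply: le_trans; rewrite ler_norm.
Qed.

(** * Common constants and assembly of the estimates *)

Lemma strongly_convexW (R : realType) n (X : set 'rV[R]_n) (m m' : R) g :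
  m' <= m -> strongly_convex X m g -> strongly_convex X m' g.
Proof.
move=> mm gm a b l Xa Xb l01; rewrite (le_trans (gm a b l Xa Xb l01))// lerD2l lerN2.
case/andP: l01 => l0 l1; have l1' : 0 <= 1 - l by rewrite subr_ge0.
by rewrite !ler_wpM2r ?sqr_ge0// invr_ge0.
Qed.

Lemma lip_onW (R : realType) m n (X : set 'rV[R]_m) (L L' : R)
    (G : 'rV[R]_m -> 'rV[R]_n) : L <= L' -> lip_on X L G -> lip_on X L' G.
Proof.
by move=> LL lG a b Xa Xb; rewrite (le_trans (lG _ _ Xa Xb))// ler_wpM2r ?enorm_ge0.
Qed.

Theorem theorem1 (R : realType) (nx ny : nat)
  (X : set 'rV[R]_nx) (Y : set 'rV[R]_ny)
  (f : nat -> 'rV[R]_nx * 'rV[R]_ny -> R)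
  (mux muy Lx Ly Lxy Lyx rho alpha : R)
  (xs x : nat -> 'rV[R]_nx) (ys y : nat -> 'rV[R]_ny)
  (* (A1) *)
  (X_neq0 : X !=set0) (Y_neq0 : Y !=set0)
  (X_compact : compact X) (Y_compact : compact Y)
  (X_convex : convex_set X) (Y_convex : convex_set Y)
  (f_cont : forall t, {within X `*` Y, continuous (f t)})
  (f_convex : forall t b, Y b -> convex_function X (fun a => f t (a, b)))
  (f_concave : forall t a, X a -> convex_function Y (fun b => - f t (a, b)))
  (* (A2) *)
  (mux_gt0 : 0 < mux) (muy_gt0 : 0 < muy)
  (f_sconvex : forall t b, Y b ->
    strongly_convex X mux (fun a => f t (a, b)))
  (f_sconcave : forall t a, X a ->
    strongly_convex Y muy (fun b => - f t (a, b)))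
  (* (A3) *)
  (f_diff : forall t, differentiable_on (X `*` Y) (f t))
  (mux_le : mux <= Lx) (muy_le : muy <= Ly)
  (gradx_lip : forall t a a' b, X a -> X a' -> Y b ->
    enorm (gradx X (f t) a b - gradx X (f t) a' b) <= Lx * enorm (a - a'))
  (grady_lip : forall t a b b', X a -> Y b -> Y b' ->
    enorm (grady Y (f t) a b - grady Y (f t) a b') <= Ly * enorm (b - b'))
  (* (A4) *)
  (Lxy_gt0 : 0 < Lxy) (Lyx_gt0 : 0 < Lyx)
  (gradx_lip_y : forall t a b b', X a -> Y b -> Y b' ->
    enorm (gradx X (f t) a b - gradx X (f t) a b') <= Lxy * enorm (b - b'))
  (grady_lip_x : forall t a a' b, X a -> X a' -> Y b ->
    enorm (grady Y (f t) a b - grady Y (f t) a' b) <= Lyx * enorm (a - a'))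
  (* Nash equilibria, in the interior *)
  (NE : forall t, nash_eq X Y (f t) (xs t) (ys t))
  (NE_interior : forall t, interior (X `*` Y) (xs t, ys t))
  (rho_gt0 : 0 < rho) (rho_lt1 : rho < 1)
  (* the algorithm *)
  (x0_in : X (x 0%N)) (y0_in : Y (y 0%N))
  (x_step : forall t,
    x t.+1 = euclid_proj X (x t - alpha *: gradx X (f t) (x t) (y t)))
  (y_step : forall t,
    y t.+1 = euclid_proj Y (y t + alpha *: grady Y (f t) (x t) (y t))) :
  let mu := Num.min mux muy in
  let L := Num.max Lx Ly in
  let Lc := Num.max Lxy Lyx in
  let beta := gda_rate mu L Lc alpha in
  let err t := enorm (x t - xs t) ^+ 2 + enorm (y t - ys t) ^+ 2 in
  let W i := 2 * diam X * path_variation xs i + 2 * diam Y * path_variation ys i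
             + path_variation xs i ^+ 2 + path_variation ys i ^+ 2 in
  let RF := forgetting_regret f rho x xs y ys in
  0 < alpha -> alpha < 2 * mu / (mu * L + Lc ^+ 2) ->
  [/\ forall t : nat,
        err t <= beta ^+ t * err 0%N
                 + \sum_(1 <= i < t.+1) beta ^+ (t - i) * W i,
      forall T : nat, (1 <= T)%N ->
        RF T <= L / 2 * (\sum_(1 <= t < T.+1)
                           rho ^+ (T - t) * beta ^+ t * err 0%N)
                + L / 2 * (\sum_(1 <= i < T.+1) \sum_(i <= t < T.+1)
                             rho ^+ (T - t) * beta ^+ (t - i) * W i) &
      path_variation xs t @[t --> \oo] --> (0 : R) ->
      path_variation ys t @[t --> \oo] --> (0 : R) ->
      RF T @[T --> \oo] --> (0 : R)].
Proof.
move=> mu L Lc beta err W RF al0 alL.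
have mu0 : 0 < mu by rewrite lt_min mux_gt0.
have muL : mu <= L by rewrite ge_min le_max mux_le.
have L0 : 0 < L by exact: lt_le_trans muL.
have Lc0 : 0 < Lc by rewrite lt_max Lxy_gt0.
have b0 : 0 <= beta by exact: gda_rate_ge0.
have b1 : beta < 1 by exact: gda_rate_lt1.
(* The sign of [Gy] makes both players minimisers, so one set of lemmas serves both blocks. *)
pose Gx t a b := gradx X (f t) a b; pose Gy t a b := - grady Y (f t) a b.
have saddle t : smooth_saddle X Y mu L Lc (f t) (Gx t) (Gy t).
  split=> [b Yb|a Xa]; split.
  - apply: strongly_convex_lower_quad => //; first exact: ltW.
      by apply: strongly_convexW (f_sconvex t b Yb); rewrite ge_min lexx.
    by move=> a Xa; apply: gradx_is_grad.
  - apply: (@lip_onW _ _ _ _ Lx); first by rewrite le_max lexx.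
    by move=> a a' Xa Xa'; exact: gradx_lip.
  - apply: (@lip_onW _ _ _ _ Lyx); first by rewrite le_max lexx orbT.
    by move=> a a' Xa Xa'; rewrite /Gy -opprD enormN; exact: grady_lip_x.
  - apply: strongly_convex_lower_quad => //; first exact: ltW.
      by apply: strongly_convexW (f_sconcave t a Xa); rewrite ge_min lexx orbT.
    by move=> b Yb; apply: is_gradN; apply: grady_is_grad.
  - apply: (@lip_onW _ _ _ _ Ly); first by rewrite le_max lexx orbT.
    by move=> b b' Yb Yb'; rewrite /Gy -opprD enormN; exact: grady_lip.
  - apply: (@lip_onW _ _ _ _ Lxy); first by rewrite le_max lexx.
    by move=> b b' Yb Yb'; exact: gradx_lip_y.
have Xx t : X (x t).
  case: t => [//|t]; rewrite x_step.
  by have [] := euclid_projP (x t - alpha *: gradx X (f t) (x t) (y t)) X_neq0 X_compact.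
have Yy t : Y (y t).
  case: t => [//|t]; rewrite y_step.
  by have [] := euclid_projP (y t + alpha *: grady Y (f t) (x t) (y t)) Y_neq0 Y_compact.
have Xs t : X (xs t) by case: (NE t).
have Ys t : Y (ys t) by case: (NE t).
have Gx0 t : Gx t (xs t) (ys t) = 0.
  have [[d d0 Bx] _] := interior_ball (NE_interior t).
  have [gX lX _] := (saddle t).1 _ (Ys t).
  apply: (grad_interior_min X_convex (ltW mu0) gX (ltW L0) lX d0 Bx) => a Xa.
  by case: (NE t) => _ _ /(_ a (ys t) Xa (Ys t))/andP[].
have Gy0 t : Gy t (xs t) (ys t) = 0.
  have [_ [d d0 By]] := interior_ball (NE_interior t).
  have [gY lY _] := (saddle t).2 _ (Xs t).
  apply: (grad_interior_min Y_convex (ltW mu0) gY (ltW L0) lY d0 By) => b Yb.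
  by rewrite lerN2; case: (NE t) => _ _ /(_ (xs t) b (Xs t) Yb)/andP[].
(* The contraction is taken between the iterate and the equilibrium, where the gradients vanish;
   projecting does not increase the distance to the equilibrium. *)
have contr t : enorm (x t.+1 - xs t) ^+ 2 + enorm (y t.+1 - ys t) ^+ 2 <= beta * err t.
  have [[d d0 Bx] [d' d0' By]] := interior_ball (NE_interior t).
  have dm : 0 < Num.min d d' by rewrite lt_min d0.
  have Bx' a : enorm (a - xs t) < Num.min d d' -> X a by rewrite lt_min => /andP[/Bx].
  have By' b : enorm (b - ys t) < Num.min d d' -> Y b by rewrite lt_min => /andP[_ /By].
  have := gda_contraction X_convex Y_convex (ltW mu0) muL (ltW Lc0) (saddle t) dm
    Bx' By' (Xs t) (Xx t) (Ys t) (Yy t) (ltW al0).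
  rewrite Gx0 Gy0 !subr0; apply: le_trans.
  apply: lerD; rewrite ler_sqr ?nnegrE ?enorm_ge0// addrAC.
    by rewrite x_step euclid_proj_le.
  by rewrite y_step /Gy scalerN opprK euclid_proj_le.
have rec t : err t.+1 <= beta * err t + W t.+1.
  (* Square |z - s'| <= |z - s| + |s' - s| and bound |z - s| by the diameter in the cross term
     only. *)
  have drift n (Z : set 'rV[R]_n) (z s s' : 'rV[R]_n) : compact Z -> Z z -> Z s ->
      enorm (z - s') ^+ 2 <= enorm (z - s) ^+ 2 +
        (2 * diam Z * enorm (s' - s) + enorm (s' - s) ^+ 2).
    move=> Zc Zz Zs; have zs := le_diam Zc Zz Zs.
    have := enorm_sub_le s z s'; rewrite (enormB s s') => h.
    have h2 : enorm (z - s') ^+ 2 <= (enorm (z - s) + enorm (s' - s)) ^+ 2.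
      by rewrite ler_sqr ?nnegrE ?addr_ge0 ?enorm_ge0.
    have h3 : enorm (z - s) * enorm (s' - s) <= diam Z * enorm (s' - s).
      by rewrite ler_wpM2r ?enorm_ge0.
    by rewrite (le_trans h2)// sqrrD; lra.
  have h1 := drift _ _ _ _ (xs t.+1) X_compact (Xx t.+1) (Xs t).
  have h2 := drift _ _ _ _ (ys t.+1) Y_compact (Yy t.+1) (Ys t).
  by have := contr t; rewrite /err /W /path_variation /=; lra.
have bound t := geometric_recursion_le t b0 rec.
(* The value at the equilibrium splits the gap in two. Each part is nonnegative by the equilibrium
   property and, with a vanishing gradient, at most quadratic by [descent]. *)
have gap t : 0 <= f t (x t, ys t) - f t (xs t, y t) <= L / 2 * err t.
  have [_ _ NEt] := NE t; have /andP[n1 n2] := NEt _ _ (Xx t) (Yy t).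
  have [gX lX _] := (saddle t).1 _ (Ys t).
  have [gY lY _] := (saddle t).2 _ (Xs t).
  have h1 := descent X_convex (ltW mu0) gX (ltW L0) lX (Xs t) (Xx t).
  have h2 := descent Y_convex (ltW mu0) gY (ltW L0) lY (Ys t) (Yy t).
  move: h1 h2; rewrite Gx0 Gy0 (dotpC 0) dotp0r (dotpC 0) dotp0r /err => h1 h2.
  by apply/andP; split; lra.
split=> [//|T _|V1 V2].
- rewrite /RF /forgetting_regret.
  apply: (@le_trans _ _ (\sum_(1 <= t < T.+1) rho ^+ (T - t) * (L / 2 *
      (beta ^+ t * err 0%N + \sum_(1 <= i < t.+1) beta ^+ (t - i) * W i)))).
    apply: ler_sum => t _; rewrite ler_wpM2l ?exprn_ge0 ?(ltW rho_gt0)//.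
    case/andP: (gap t) => _ /le_trans; apply.
    by rewrite ler_wpM2l// divr_ge0// ltW.
  rewrite -mulrDr -sum_triangle -big_split mulr_sumr /=.
  rewrite le_eqVlt; apply/orP; left; apply/eqP; apply: eq_bigr => t _.
  rewrite mulrCA mulrDr mulrA mulr_sumr; congr (_ * (_ + _)).
  by apply: eq_bigr => i _; rewrite mulrA.
- have err0 t : 0 <= err t by rewrite addr_ge0 ?sqr_ge0.
  have W0 : W t @[t --> \oo] --> (0 : R).
    rewrite (_ : 0 = 2 * diam X * 0 + 2 * diam Y * 0 + 0 ^+ 2 + 0 ^+ 2); last by ring.
    apply: cvgD; [apply: cvgD; [apply: cvgD|]|].
    + by apply: cvgM => //; exact: cvg_cst.
    + by apply: cvgM => //; exact: cvg_cst.
    + by rewrite expr2; under eq_cvg do rewrite expr2; exact: cvgM.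
    + by rewrite expr2; under eq_cvg do rewrite expr2; exact: cvgM.
  have e0 : err t @[t --> \oo] --> (0 : R).
    apply: (@geometric_recursion_cvg0 _ _ (fun t => W t.+1) beta) => //.
      by rewrite b0.
    by have := W0; rewrite -cvg_shiftS.
  have gap0 t : 0 <= f t (x t, ys t) - f t (xs t, y t) by case/andP: (gap t).
  (* The regret obeys its own recursion: passing from T to T + 1 multiplies it by [rho] and adds the
     gap at T + 1, which tends to 0 with [err]. *)
  apply: (@geometric_recursion_cvg0 _ _ (fun t => L / 2 * err t.+1) rho) => //.
  + by rewrite rho_lt1 ltW.
  + by move=> T; apply: sumr_ge0 => t _; rewrite mulr_ge0// exprn_ge0// ltW.
  + move=> T; rewrite /RF /forgetting_regret big_nat_recr//= subnn mul1r lerD//.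
      rewrite mulr_sumr le_eqVlt; apply/orP; left; apply/eqP.
      rewrite big_nat [RHS]big_nat; apply: eq_bigr => t /andP[_ tT].
      by rewrite subSn// exprS mulrA.
    by case/andP: (gap T.+1).
  + rewrite -(mulr0 (L / 2)); apply: cvgM; first exact: cvg_cst.
    by have := e0; rewrite -cvg_shiftS.
Qed.
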